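(* Let $G$ be a graph on $[n+1]$ with $m$ edges satisfying the standing assumptions below, and let ${\bf a}=(a_1,\ldots,a_n,-\sum a_i)$ with $a_i\in\mathbb{Z}_{>0}$. The following numbers are all equal: (a) the number of cells of the canonical subdivision of $\mathcal{F}_G({\bf a})$; (b) the sum $\sum_{{\bf j}}K_G(j_1-{\rm out}_1,\ldots,j_n-{\rm out}_n,0)$ over weak compositions ${\bf j}=(j_1,\ldots,j_n)$ of $m-n$ that are $\ge({\rm out}_1,\ldots,{\rm out}_n)$ in dominance order; (c) the number of lattice points of $\mathcal{F}_{G^\star}(m-n,-{\rm out}_1,\ldots,-{\rm out}_n,0)$; (d) ${\rm vol}\,\mathcal{F}_{G^\star}(1,0,\ldots,0,-1)$; (e) ${\rm vol}\,\mathcal{F}_{G^\circ}(1,0,\ldots,0,-1)$.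
   Context: Standing assumptions: $G$ is a connected directed multigraph without loops on $[n+1]$, edges directed $i\to j$ with $i<j$, each vertex $1,\ldots,n$ has an outgoing edge; ${\rm out}_i$ is the outdegree of $i$ minus $1$. $G^\star$ (resp. $G^\circ$) is the graph on $\{0,1,\ldots,n+1\}$ obtained from $G$ by adding vertex $0$ and edges $(0,i)$ for $i=1,\ldots,n$ (resp. $i=1,\ldots,n+1$); netflow vectors for these graphs are indexed by the vertices $0,1,\ldots,n+1$ in order. For a graph $H$ and netflow vector ${\bf v}$ (summing to $0$), $\mathcal{F}_H({\bf v})$ is the set of $f\in\mathbb{R}_{\ge0}^{E(H)}$ with outflow minus inflow at each vertex $k$ equal to $v_k$, and $K_H({\bf v})$ is the number of such $f$ with integer entries. ${\rm vol}$ is normalized volume (unimodular simplices in the lattice of the affine hull have volume $1$). Dominance order: ${\bf j}\ge{\bf k}$ iff $j_1+\cdots+j_l\ge k_1+\cdots+k_l$ for all $l$. Noncrossing trees: $\mathcal{T}_{L,R}$ for ordered lists $L=(x_1,\ldots,x_\ell)$, $R=(y_1,\ldots,y_r)$ is the set of trees on $L\sqcup R$ with all edges between $L$ and $R$ and no edges $(x_p,y_q),(x_t,y_u)$ with $p<t$, $q>u$. Compounded reduction at vertex $i\in\{2,\ldots,n\}$ of a graph $H$ in which $i$ has incoming edges (here $a_i>0$): with $\mathcal{I}_i(H)$, $\mathcal{O}_i(H)$ the multisets of edges $(\cdot,i)$, $(i,\cdot)$ in fixed orderings, $L=(\mathcal{I}_i(H),v_i)$ ($v_i$ new, last), $R=\mathcal{O}_i(H)$;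 for $T\in\mathcal{T}_{L,R}$, $H^{(i)}_T$ is $H$ with $\mathcal{I}_i(H)\cup\mathcal{O}_i(H)$ deleted and, for each tree edge, an edge $(r,s)$ added if it joins $(r,i)$ and $(i,s)$, or $(i,s)$ if it joins $v_i$ and $(i,s)$; new edges are formal sums of edges of $G$ and $\mathcal{F}_H({\bf a})$ is identified with its image in $\mathbb{R}^{E(G)}$ under $g\mapsto f$, $f(e)=\sum g(e')$ over edges $e'$ having $e$ as summand. Canonical compounded reduction tree: root $G$; for $i=n,\ldots,2$ in order, each current leaf $H$ in which $i$ has incoming edges gets children $H^{(i)}_T$, $T\in\mathcal{T}_{L,R}$. The cells of the canonical subdivision of $\mathcal{F}_G({\bf a})$ are the polytopes $\mathcal{F}_H({\bf a})$, one for each leaf $H$. *)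

(* Defs.v *)
From HB Require Import structures.
From mathcomp Require Import all_boot all_order all_algebra.
From mathcomp Require Import finmap.
From mathcomp Require Import boolp classical_sets cardinality reals topology normedtype sequences.
Set Implicit Arguments. Unset Strict Implicit. Unset Printing Implicit Defensive.
Import Order.TTheory GRing.Theory Num.Theory numFieldNormedType.Exports.
Local Open Scope classical_set_scope.
Local Open Scope ring_scope.

(* ---------- directed multigraphs: a list of edges (i, j) on vertices in nat ---------- *)
Definition edge := (nat * nat)%type.

Definition ethe (E : seq edge) (e : 'I_(size E)) : edge := nth (0%N, 0%N) E e.

Definition netflow (V : zmodType) (E : seq edge) (f : 'I_(size E) -> V) (k : nat) : V :=
  \sum_(e < size E | (ethe e).1 == k) f e - \sum_(e < size E | (ethe e).2 == k) f e.
Arguments netflow {V} E f k.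

(* flow polytope F_H(v) in R^{E(H)}; v is the netflow vector, indexed by vertices
   (v k = 0 for every k that is not a vertex of H, so the constraint at such k is void) *)
Definition flow_polytope (R : realType) (E : seq edge) (v : nat -> int)
  : set 'rV[R]_(size E) :=
  [set f | (forall e, 0 <= f ord0 e) /\ forall k, netflow E (fun e => f ord0 e) k = (v k)%:~R].

Arguments flow_polytope R E v : clear implicits.

Definition Kcount (E : seq edge) (v : nat -> int) : nat :=
  #|` fset_set [set g : {ffun 'I_(size E) -> int} |
                  (forall e, 0 <= g e) /\ forall k, netflow E g k = v k] |.

Definition lattice_points (R : realType) (m : nat) (P : set 'rV[R]_m) : nat :=
  #|` fset_set [set g : {ffun 'I_m -> int} | P (\row_e (g e)%:~R)] |.

Definition grid_count (R : realType) (m : nat) (P : set 'rV[R]_m) (t : nat) : nat :=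
  #|` fset_set [set g : {ffun 'I_m -> int} | P (\row_e ((g e)%:~R / t%:R))] |.

Definition diffs (R : realType) (m k : nat) (ps : 'M[R]_(k.+1, m)) : 'M[R]_(k, m) :=
  \matrix_(i < k, j < m) (ps (lift ord0 i) j - ps ord0 j).

Definition affine_dim (R : realType) (m : nat) (P : set 'rV[R]_m) (d : nat) : Prop :=
  (exists ps : 'M[R]_(d.+1, m), (forall i, P (row i ps)) /\ \rank (diffs ps) = d) /\
  (forall k (ps : 'M[R]_(k.+1, m)), (forall i, P (row i ps)) -> (\rank (diffs ps) <= d)%N).

(* normalized volume: d! times the volume relative to the lattice Z^m (restricted to the
   affine hull), the relative volume being the Jordan content
   lim_{t -> oo} #(P \cap (1/t) Z^m) / t^d, d = dim P *)
Definition has_normalized_volume (R : realType) (m : nat) (P : set 'rV[R]_m) (V : R) : Prop :=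
  exists d, affine_dim P d /\
    ((fun t : nat => (grid_count P t)%:R / (t%:R ^+ d)) @ \oo --> V / (d`!)%:R).

Definition outdeg (E : seq edge) (k : nat) : nat := count (fun e : edge => e.1 == k) E.
Definition outm (E : seq edge) (k : nat) : nat := (outdeg E k).-1.

Definition undirected_adj (E : seq edge) : rel nat :=
  fun x y => ((x, y) \in E) || ((y, x) \in E).

Definition standing_graph (n : nat) (E : seq edge) : Prop :=
  [/\ (forall e, e \in E -> [&& (1 <= e.1)%N, (e.1 < e.2)%N & (e.2 <= n.+1)%N]),
      (forall k, (1 <= k <= n)%N -> has (fun e : edge => e.1 == k) E) &
      (forall x y, (1 <= x <= n.+1)%N -> (1 <= y <= n.+1)%N ->
         exists p, path (undirected_adj E) x p /\ last x p = y)].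

Definition Gstar (n : nat) (E : seq edge) : seq edge := [seq (0%N, i) | i <- iota 1 n] ++ E.
Definition Gcirc (n : nat) (E : seq edge) : seq edge := [seq (0%N, i) | i <- iota 1 n.+1] ++ E.

Definition bip_adj (l r : nat) (T : {set 'I_l * 'I_r}) : rel ('I_l + 'I_r) :=
  fun x y => match x, y with
             | inl p, inr q => (p, q) \in T
             | inr q, inl p => (p, q) \in T
             | _, _ => false
             end.

Definition nc_tree (l r : nat) (T : {set 'I_l * 'I_r}) : bool :=
  [&& #|T| == (l + r).-1,
      [forall x, forall y, connect (bip_adj T) x y] &
      [forall p1, forall q1, forall p2, forall q2,
         ((p1, q1) \in T) && ((p2, q2) \in T) ==> ~~ ((p1 < p2)%N && (q2 < q1)%N)]].

(* H^{(i)}_T : Ins = ordered I_i(H) (L = Ins followed by v_i), Outs = ordered O_i(H) *)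
Definition reduce_child (i : nat) (H Ins Outs : seq edge)
    (T : {set 'I_(size Ins).+1 * 'I_(size Outs)}) : seq edge :=
  [seq e <- H | (e.1 != i) && (e.2 != i)] ++
  [seq ((if (val pq.1 < size Ins)%N then (nth (0%N, 0%N) Ins pq.1).1 else i),
        (nth (0%N, 0%N) Outs pq.2).2) | pq : ('I_(size Ins).+1 * 'I_(size Outs)) <- enum T].

Arguments reduce_child i H Ins Outs T : clear implicits.

(* canon_leaves i H c : processing the vertices i, i-1, ..., 2 in this order, starting
   from the single node H (with any choice of the fixed orderings at each node), the
   resulting compounded reduction tree has c leaves *)
Fixpoint canon_leaves (i : nat) (H : seq edge) (c : nat) : Prop :=
  match i with
  | 0 => c = 1%N
  | i'.+1 =>
    if (i'.+1 < 2)%N then c = 1%N else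
    if ~~ has (fun e : edge => e.2 == i'.+1) H then canon_leaves i' H c else
    exists (Ins Outs : seq edge),
      [/\ perm_eq Ins [seq e <- H | e.2 == i'.+1],
          perm_eq Outs [seq e <- H | e.1 == i'.+1] &
          exists cT : {set 'I_(size Ins).+1 * 'I_(size Outs)} -> nat,
            (forall T : {set 'I_(size Ins).+1 * 'I_(size Outs)}, nc_tree T -> canon_leaves i' (reduce_child i'.+1 H Ins Outs T) (cT T))
            /\ c = (\sum_(T | nc_tree T) cT T)%N]
  end.

(* number of cells of the canonical subdivision of F_G(a) = number of leaves of the
   canonical compounded reduction tree (root G, vertices n, ..., 2) *)
Definition canonical_cells (n : nat) (E : seq edge) (c : nat) : Prop := canon_leaves n E c.

Definition bvec (n : nat) (E : seq edge) (j : 'I_n -> nat) (k : nat) : int :=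
  if (1 <= k <= n)%N then (nth 0%N [seq j i | i <- enum 'I_n] k.-1)%:Z - (outm E k)%:Z
  else 0.

Arguments bvec n E j k : clear implicits.

(* j (a weak composition of m - n, so entries <= m - n) is >= (out_1, ..., out_n) in
   dominance order *)
Definition weak_comp_dom (n : nat) (E : seq edge) (j : {ffun 'I_n -> 'I_(size E - n).+1}) : bool :=
  ((\sum_(i < n) (j i : nat))%N == (size E - n)%N) &&
  [forall l : 'I_n.+1,
     (\sum_(i < n | (i < l)%N) outm E i.+1 <= \sum_(i < n | (i < l)%N) (j i : nat))%N].

Arguments weak_comp_dom n E j : clear implicits.

Definition sum_b (n : nat) (E : seq edge) : nat :=
  (\sum_(j : {ffun 'I_n -> 'I_(size E - n).+1} | weak_comp_dom n E j)
     Kcount E (bvec n E (fun i => j i)))%N.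

Definition cvec (n : nat) (E : seq edge) (k : nat) : int :=
  if k == 0%N then (size E - n)%:Z
  else if (k <= n)%N then - (outm E k)%:Z else 0.

Definition srcsink (n : nat) (k : nat) : int :=
  if k == 0%N then 1 else if k == n.+1 then -1 else 0.

(* Main.v *)
(** Everything is compared with the integer flows on G^star with netflow
    (m - n, -out_1, ..., -out_n, 0).

    Cells.  A noncrossing tree is a maximal chain (a staircase) in the product order, hence
    determined by its left degrees, and these are arbitrary positive numbers with the right sum.
    Reducing at i therefore distributes the current outdegree minus 1 of i over the edges into i
    and over v_i; reading the share of v_i as the flow on (0, i), a leaf is an integer flow.

    Volumes.  By the Lidskii formula
      K_H(a) = sum_j prod_i binom(a_i + out_i, j_i) K_H(j - out),
    the number of points of (1/t)Z^E in F_H(1, 0, ..., 0, -1) is a combination of the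
    binom(t + out_0, j_0) with j_0 <= d = dim F_H, where j_0 = d occurs only for
    j = (d, 0, ..., 0).  Its leading coefficient is K_H(d - out_0, -out_1, ..., -out_n, 0) / d!. *)
Require Import Defs.
From HB Require Import structures.
From mathcomp Require Import all_boot all_order all_algebra.
From mathcomp Require Import finmap.
From mathcomp Require Import boolp classical_sets cardinality reals topology normedtype sequences.
From mathcomp Require Import zify ring.
Set Implicit Arguments. Unset Strict Implicit. Unset Printing Implicit Defensive.
Import Order.TTheory GRing.Theory Num.Theory numFieldNormedType.Exports.
Local Open Scope classical_set_scope.
Local Open Scope ring_scope.

(** * Counting integer flows *)

(** The Lidskii formula is proved by induction on an edge list sorted by tail, so that the edge (u,
    v) taken off always starts at a vertex without incoming edges. Its flow x runs over 0, ..., a_u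
    and moves x units from a_u to a_v. The induction hypothesis turns the count into a sum over x of
    binomial transforms in j_u and j_v, a geometric sum of shift operators. Taking off the edge may
    leave u without outgoing edges; there the truncated predecessor makes out_u equal to 0 instead
    of -1. Hence the formula asks for a_i = 0 at vertices without outgoing edges, and this last edge
    out of u is a case of its own. For the volumes, the growth exponent of the grid counts must also
    be shown to be the dimension of the polytope. The upper bound comes from the rank of the
    incidence matrix, the lower one from a flow that is positive on every edge. *)

Definition dv (e : edge) (k : nat) : int := (e.1 == k)%:Z - (e.2 == k)%:Z.

Definition forward (E : seq edge) := all (fun e : edge => (e.1 < e.2)%N) E.

Definition is_flow (E : seq edge) (v : nat -> int) (g : 'I_(size E) -> int) : Prop :=
  (forall e, 0 <= g e) /\ forall k, netflow E g k = v k.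

Lemma netflowE (R : pzRingType) (E : seq edge) (f : 'I_(size E) -> R) k :
  netflow E f k = \sum_i f i * (dv (ethe i) k)%:~R.
Proof.
rewrite /netflow big_mkcond /= [X in _ - X]big_mkcond /= -sumrB.
apply: eq_bigr => i _; rewrite /dv rmorphB /= mulrBr.
by case: (_ == _); case: (_ == _); rewrite /= ?mulr1 ?mulr0.
Qed.

Lemma netflow_cons e (E : seq edge) (f : 'I_(size E).+1 -> int) k :
  netflow (e :: E) f k = f ord0 * dv e k + netflow E (fun i => f (lift ord0 i)) k.
Proof.
rewrite !netflowE big_ord_recl intz; congr (_ + _).
Qed.

Lemma sum_dv (e : edge) N :
  (e.1 < e.2)%N -> \sum_(k < N) dv e k = ((e.1 < N)%N && (N <= e.2)%N)%:Z.
Proof.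
move=> lt12; elim: N => [|N IH]; first by rewrite big_ord0.
rewrite big_ord_recr /= {}IH /dv.
case: (ltngtP e.1 N) => ?; case: (ltngtP e.2 N) => ?; lia.
Qed.

Lemma sum_netflow (E : seq edge) (f : 'I_(size E) -> int) N : forward E ->
  \sum_(k < N) netflow E f k =
  \sum_i f i * (((ethe i).1 < N)%N && (N <= (ethe i).2)%N)%:Z.
Proof.
move=> /(all_nthP (0%N, 0%N)) fE.
under eq_bigr do rewrite netflowE.
rewrite exchange_big /=; apply: eq_bigr => i _.
by rewrite -mulr_sumr; under eq_bigr do rewrite intz; rewrite sum_dv ?fE.
Qed.

(** Cut identity: a forward edge contributes to the vertices below N exactly when it crosses from
    below N to N or beyond. The finiteness of the set of integer flows and the prefix criteria for
    [Kcount] to vanish rest on it. *)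
Lemma flow_prefix (E : seq edge) v g N : forward E -> is_flow (E := E) v g ->
  \sum_(k < N) v k = \sum_i g i * (((ethe i).1 < N)%N && (N <= (ethe i).2)%N)%:Z.
Proof.
by move=> fE [_ gv]; rewrite -sum_netflow//; apply: eq_bigr => k _; rewrite gv.
Qed.

Lemma flow_prefix_ge0 (E : seq edge) v g N : forward E -> is_flow (E := E) v g ->
  0 <= \sum_(k < N) v k.
Proof.
move=> fE gv; rewrite (flow_prefix N fE gv) sumr_ge0// => i _.
by rewrite mulr_ge0//; case: gv.
Qed.

Lemma flow_le (E : seq edge) v g i : forward E -> is_flow (E := E) v g ->
  g i <= \sum_(k < (ethe i).1.+1) v k.
Proof.
move=> fE gv; rewrite (flow_prefix _ fE gv) (bigD1 i)//= ltnSn /=.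
have -> : ((ethe i).1 < (ethe i).2)%N by move/(all_nthP (0%N, 0%N)): fE => ->.
rewrite mulr1 lerDl sumr_ge0// => j _.
by rewrite mulr_ge0//; case: gv.
Qed.

Definition fcons (T : Type) m (x : T) (h : {ffun 'I_m -> T}) : {ffun 'I_m.+1 -> T} :=
  [ffun i => oapp h x (unlift ord0 i)].

Lemma fcons0 T m (x : T) (h : {ffun 'I_m -> T}) : fcons x h ord0 = x.
Proof. by rewrite ffunE unlift_none. Qed.

Lemma fconsS T m (x : T) (h : {ffun 'I_m -> T}) i : fcons x h (lift ord0 i) = h i.
Proof. by rewrite ffunE liftK. Qed.

Lemma sum_ffun_recl (T : finType) m (F : {ffun 'I_m.+1 -> T} -> nat) :
  (\sum_h F h = \sum_x \sum_(h : {ffun 'I_m -> T}) F (fcons x h))%N.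
Proof.
rewrite pair_big /=.
rewrite (reindex (fun p : T * {ffun 'I_m -> T} => fcons p.1 p.2)) //=.
exists (fun h => (h ord0, [ffun i => h (lift ord0 i)])) => [[x h] _ | h _] /=.
  by congr (_, _); [rewrite fcons0 | apply/ffunP => i; rewrite ffunE fconsS].
apply/ffunP => i; rewrite ffunE; case: unliftP => [j|] -> //=.
by rewrite ffunE.
Qed.

(** [fset_set] is empty on infinite sets, so a count is meaningful only with finiteness at hand.
    Confinement to a box provides it and turns the count into a sum over a finite type, which can be
    split and reindexed. *)
Lemma card_fset_set_bounded m (P : {ffun 'I_m -> int} -> Prop) (B : nat) :
  (forall g, P g -> forall i, 0 <= g i < B%:Z) ->
  #|` fset_set P| =
  (\sum_(h : {ffun 'I_m -> 'I_B}) `[< P [ffun i => (h i : nat)%:Z] >])%N.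
Proof.
move=> PB; pose f (h : {ffun 'I_m -> 'I_B}) : {ffun 'I_m -> int} := [ffun i => (h i : nat)%:Z].
pose X := [fset f h | h in [pred h | `[< P (f h) >]]]%fset.
have PX : P = [set` X]%classic.
  apply/seteqP; split => g /=; last by case/imfsetP => h /= /asboolP Ph ->.
  move=> Pg; apply/imfsetP.
  have Bi i : (`|g i|%N < B)%N by have := PB _ Pg i; lia.
  have gE : g = f [ffun i => Ordinal (Bi i)].
    by apply/ffunP => i; rewrite !ffunE /=; have := PB _ Pg i; lia.
  by exists [ffun i => Ordinal (Bi i)] => //=; apply/asboolP; rewrite -gE.
have -> : fset_set P = X by rewrite PX set_fsetK.
rewrite card_imfset /=; last first.
  by move=> h h' /ffunP hh'; apply/ffunP => i; apply/val_inj; have := hh' i; rewrite !ffunE => -[].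
rewrite -cardE -sum1_card big_mkcond /=; apply: eq_bigr => h _.
by rewrite unfold_in -/(f h); case: `[< _ >].
Qed.

Lemma KcountE (E : seq edge) (v : nat -> int) (B : nat) : forward E ->
  (forall i, \sum_(k < (ethe (E := E) i).1.+1) v k < B%:Z) ->
  Kcount E v =
  (\sum_(h : {ffun 'I_(size E) -> 'I_B}) `[< is_flow v (fun i => (h i : nat)%:Z) >])%N.
Proof.
move=> fE vB; rewrite /Kcount (card_fset_set_bounded (B := B)).
  apply: eq_bigr => h _; congr (nat_of_bool _); apply: asbool_equiv_eq.
  rewrite [X in _ <-> X](_ : _ = is_flow v (fun i => [ffun i => (h i : nat)%:Z] i))//.
  by congr is_flow; apply/funext => i; rewrite ffunE.
move=> g /= gv i; have [g0 _] := gv; rewrite g0 /=.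
exact: le_lt_trans (flow_le i fE gv) (vB i).
Qed.

(** Stated for every [B] beyond a threshold, so that it combines with another bound by taking a
    maximum. *)
Lemma prefix_bound (E : seq edge) (v : nat -> int) :
  exists B0 : nat, forall B, (B0 <= B)%N -> forall e, e \in E -> \sum_(k < e.1.+1) v k < B%:Z.
Proof.
elim: E => [|e E [B0 IH]]; first by exists 0%N.
exists (maxn B0 `|\sum_(k < e.1.+1) v k|.+1) => B; rewrite geq_max => /andP[B0B eB] e'.
rewrite inE => /predU1P[->|/IH->//]; move: eB; set S := \sum_(k < _) _ => eB; lia.
Qed.

Lemma Kcount_gt0 (E : seq edge) v : forward E -> (0 < Kcount E v)%N -> exists g, is_flow (E := E)
  v g.
Proof.
move=> fE; have [B0 /(_ _ (leqnn _)) vB] := prefix_bound E v.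
rewrite (KcountE fE (B := B0)); last by move=> i; apply: vB; rewrite /ethe mem_nth.
rewrite lt0n sum_nat_eq0 negb_forall => /existsP[h].
by case: asboolP => // hv _; exists (fun i => (h i : nat)%:Z).
Qed.

Lemma Kcount0 (E : seq edge) v : forward E -> (forall g, ~ is_flow (E := E) v g) -> Kcount E v =
  0%N.
Proof.
by move=> fE nv; apply/eqP; rewrite -leqn0 leqNgt; apply/negP => /(Kcount_gt0 fE)[g /nv].
Qed.

Lemma Kcount_prefix_lt0 (E : seq edge) (v : nat -> int) N :
  forward E -> \sum_(k < N) v k < 0 -> Kcount E v = 0%N.
Proof.
by move=> fE v0; apply: Kcount0 => // g /(flow_prefix_ge0 N fE); rewrite leNgt v0.
Qed.

Lemma Kcount_prefix_neq0 (E : seq edge) (v : nat -> int) N : forward E ->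
  (forall e, e \in E -> (N <= e.1)%N || (e.2 < N)%N) ->
  \sum_(k < N) v k != 0 -> Kcount E v = 0%N.
Proof.
move=> fE NE v0; apply: Kcount0 => // g gv; move: v0.
rewrite (flow_prefix N fE gv) big1 ?eqxx// => i _.
by have /NE := mem_nth (0%N, 0%N) (ltn_ord i); rewrite -/(ethe i) => /orP[]; case: ltngtP;
  rewrite ?mulr0 ?andbF //=; lia.
Qed.

Lemma Kcount_sink_gt0 (E : seq edge) (v : nat -> int) w : forward E ->
  (forall e, e \in E -> e.1 != w) -> 0 < v w -> Kcount E v = 0%N.
Proof.
move=> fE wE v0; apply: Kcount0 => // g [g0 gv].
move: v0; rewrite -gv /netflow big1 ?sub0r ?oppr_gt0 => [|i]; last first.
  by rewrite (negbTE (wE _ (mem_nth _ (ltn_ord i)))).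
by rewrite ltNge sumr_ge0.
Qed.

Lemma Kcount_source_lt0 (E : seq edge) (v : nat -> int) w : forward E ->
  (forall e, e \in E -> e.2 != w) -> v w < 0 -> Kcount E v = 0%N.
Proof.
move=> fE wE v0; apply: Kcount0 => // g [g0 gv].
move: v0; rewrite -gv /netflow [X in _ - X]big1 ?subr0 => [|i]; last first.
  by rewrite (negbTE (wE _ (mem_nth _ (ltn_ord i)))).
by rewrite ltNge sumr_ge0.
Qed.

Lemma Kcount_isolated (E : seq edge) (v : nat -> int) w : forward E ->
  (forall e, e \in E -> (e.1 != w) && (e.2 != w)) -> v w != 0 -> Kcount E v = 0%N.
Proof.
move=> fE wE; rewrite neq_lt => /orP[] v0.
  by apply: (Kcount_source_lt0 (w := w)) => // e /wE /andP[].
by apply: (Kcount_sink_gt0 (w := w)) => // e /wE /andP[].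
Qed.

Lemma eq_Kcount (E : seq edge) v v' : v =1 v' -> Kcount E v = Kcount E v'.
Proof. by move=> vv'; have -> : v = v' by apply/funext. Qed.

(** * Summing out edges one at a time, and invariance under permutation of the edges *)

Definition residual (v : nat -> int) (e : edge) (x : nat) : nat -> int :=
  fun k => v k - x%:Z * dv e k.

Lemma prefix_residual (e : edge) (v : nat -> int) (x : nat) N : (e.1 < e.2)%N ->
  \sum_(k < N) residual v e x k =
  \sum_(k < N) v k - x%:Z * ((e.1 < N)%N && (N <= e.2)%N)%:Z.
Proof. by move=> lt12; rewrite sumrB -mulr_sumr sum_dv. Qed.

Lemma is_flow_fcons e (E : seq edge) v B (x : 'I_B) (h : {ffun 'I_(size E) -> 'I_B}) :
  is_flow (E := e :: E) v (fun i => (fcons x h i : nat)%:Z) <->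
  is_flow (residual v e x) (fun i => (h i : nat)%:Z).
Proof.
have E1 k : netflow (e :: E) (fun i => (fcons x h i : nat)%:Z) k =
    (x : nat)%:Z * dv e k + netflow E (fun i => (h i : nat)%:Z) k.
  rewrite netflow_cons fcons0; congr (_ + _).
  by rewrite !netflowE; apply: eq_bigr => i _; rewrite fconsS.
split=> -[_ gv]; split=> // k.
  by rewrite /residual -gv E1 addrAC subrr add0r.
by rewrite E1 gv /residual addrC subrK.
Qed.

(** The flow on the first edge is fixed and summed out. For [x >= B] the residual supply up to the
    tail of [e] is negative, so any [B] above that supply gives the same sum. *)
Lemma Kcount_cons e (E : seq edge) (v : nat -> int) (B : nat) : forward (e :: E) ->
  \sum_(k < e.1.+1) v k < B%:Z ->
  Kcount (e :: E) v = (\sum_(x < B) Kcount E (residual v e x))%N.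
Proof.
move=> fE vB; have /andP[lt12 fE'] := fE.
have [B0 B0P] := prefix_bound (e :: E) v.
pose C := maxn B0 B; have vC := B0P C (leq_maxl _ _).
rewrite (KcountE fE (B := C)); last by move=> i; apply: vC; rewrite /ethe mem_nth.
rewrite sum_ffun_recl.
transitivity (\sum_(x < C) Kcount E (residual v e x))%N.
  apply: eq_bigr => x _; rewrite (KcountE fE' (B := C)) => [|i].
    apply: eq_bigr => h _; congr (nat_of_bool _).
    by apply: asbool_equiv_eq; exact: is_flow_fcons.
  rewrite prefix_residual//; apply: le_lt_trans (vC (ethe i) _); last first.
    by rewrite inE /ethe mem_nth ?orbT.
  by rewrite gerBl.
rewrite -!(big_mkord xpredT (fun x : nat => Kcount E (residual v e x))).
rewrite (big_cat_nat _ _ (n := B))//= ?leq_maxr// [X in (_ + X)%N]big_nat_cond [X in (_ +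
  X)%N]big1 ?addn0//.
move=> x /andP[/andP[Bx _] _]; apply: (Kcount_prefix_lt0 (N := e.1.+1)) => //.
rewrite prefix_residual// ltnSn lt12 /= mulr1 subr_lt0.
by apply: lt_le_trans vB _; rewrite lez_nat.
Qed.

Lemma residualC v e e' x x' : residual (residual v e x) e' x' = residual (residual v e' x') e x.
Proof. by apply/funext => k; rewrite /residual addrAC. Qed.

(** Flows are functions on the positions of the edge list, so permuting the list changes their type.
    Summing out the first two edges in either order avoids any transport, and adjacent swaps
    generate all permutations. *)
Lemma Kcount_swap e e' (E : seq edge) v : forward (e :: e' :: E) ->
  Kcount (e :: e' :: E) v = Kcount (e' :: e :: E) v.
Proof.
move=> fE; have /and3P[lt1 lt2 fE'] := fE.
have fE2 : forward (e' :: e :: E) by rewrite /= lt2 lt1.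
have [B /(_ B (leqnn B)) vB] := prefix_bound (e :: e' :: E) v.
have resB e1 e2 x : (e2.1 < e2.2)%N -> e1 \in e :: e' :: E ->
    \sum_(k < e1.1.+1) residual v e2 x k < B%:Z.
  move=> e2lt e1E; rewrite prefix_residual//; apply: le_lt_trans (vB e1 e1E).
  by rewrite gerBl.
rewrite (Kcount_cons (B := B))// ?vB ?mem_head// (Kcount_cons (B := B) fE2) ?vB ?inE ?eqxx ?orbT//.
under eq_bigr => x _.
  rewrite (Kcount_cons (B := B)) /= ?lt2// ?resB ?inE ?eqxx ?orbT//; over.
under [in RHS]eq_bigr => x _.
  rewrite (Kcount_cons (B := B)) /= ?lt1// ?resB ?inE ?eqxx ?orbT//; over.
rewrite exchange_big /=; apply: eq_bigr => x _; apply: eq_bigr => x' _.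
by rewrite residualC.
Qed.

Lemma eq_Kcount_cons e (E E' : seq edge) v : forward (e :: E) -> forward E' ->
  (forall v, Kcount E v = Kcount E' v) -> Kcount (e :: E) v = Kcount (e :: E') v.
Proof.
move=> fE fE' EE'; have /andP[lt12 _] := fE.
have [B /(_ B (leqnn B) e (mem_head _ _)) vB] := prefix_bound (e :: E) v.
rewrite (Kcount_cons fE vB) (Kcount_cons _ vB) /= ?lt12//.
by apply: eq_bigr.
Qed.

Lemma Kcount_rem e (E : seq edge) v : forward E -> e \in E ->
  Kcount E v = Kcount (e :: rem e E) v.
Proof.
elim: E v => // e' E IH v fE; rewrite inE => /predU1P[->|eE]; first by rewrite /= eqxx.
have /andP[lt' fE'] := fE; rewrite /=; case: eqP => [->//|ee'].
have fr : forward (e :: rem e E) by rewrite /= (allP fE' _ eE) /=;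
  apply/allP => ? /mem_rem /(allP fE').
rewrite (eq_Kcount_cons (E' := e :: rem e E))//; last by move=> w; apply: IH.
by rewrite Kcount_swap//= lt'.
Qed.

Lemma Kcount_perm (E E' : seq edge) v : forward E -> perm_eq E E' -> Kcount E v = Kcount E' v.
Proof.
elim: E E' v => [|e E IH] E' v fE; first by rewrite perm_sym => /perm_nilP ->.
move=> pE; have eE' : e \in E' by rewrite -(perm_mem pE) mem_head.
have fE' : forward E' by rewrite /forward -(perm_all _ pE).
have pE2 : perm_eq E (rem e E').
  by rewrite -(perm_cons e) (perm_trans pE)// perm_to_rem.
rewrite [RHS](Kcount_rem v fE' eE'); apply: eq_Kcount_cons => // [|w].
  by apply/allP => x /mem_rem /(allP fE').
by apply: IH => //; case/andP: fE.
Qed.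

Lemma Kcount_mkseq_cat (g : nat -> edge) r (E : seq edge) (v : nat -> int) (B : nat) :
  forward (mkseq g r ++ E) ->
  (forall i, (i < r)%N -> \sum_(k < (g i).1.+1) v k < B%:Z) ->
  Kcount (mkseq g r ++ E) v =
  (\sum_(y : {ffun 'I_r -> 'I_B})
     Kcount E (fun k => (v k - \sum_(i < r) (y i : nat)%:Z * dv (g i) k)%R))%N.
Proof.
elim: r g v => [|r IH] g v fE vB.
  have y0 : {ffun 'I_0 -> 'I_B} by apply: finfun; case.
  rewrite (big_pred1 y0); last by move=> y /=; apply/esym/eqP/ffunP; case.
  by apply: eq_Kcount => k; rewrite big_ord0 subr0.
have mkS : mkseq g r.+1 = g 0%N :: mkseq (g \o S) r.
  by rewrite /mkseq /= -[1%N]add1n iotaDl -map_comp.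
move: fE; rewrite mkS => fE; have /andP[lt12 fE'] := fE.
rewrite cat_cons (Kcount_cons fE (vB 0%N _))// sum_ffun_recl.
apply: eq_bigr => x _; rewrite (IH (g \o S))//; last first.
  move=> i ir; rewrite prefix_residual//; apply: le_lt_trans (vB i.+1 ir).
  by rewrite gerBl.
apply: eq_bigr => h _; apply: eq_Kcount => k.
rewrite big_ord_recl fcons0 opprD addrA; congr (_ - _).
by apply: eq_bigr => i _; rewrite fconsS.
Qed.

Lemma Kcount_drop_sink w (E : seq edge) v : forward E -> (forall e, e \in E -> e.1 != w) ->
  v w = 0 -> Kcount E v = Kcount [seq e <- E | e.2 != w] v.
Proof.
elim: E v => [//|e E IH] v fE wE vw.
have /andP[lt12 fE'] := fE.
have wE' e' : e' \in E -> e'.1 != w by move=> e'E; apply: wE; rewrite inE e'E orbT.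
have ew : e.1 != w by apply: wE; rewrite mem_head.
have [B0 /(_ _ _ e (mem_head _ _)) vB] := prefix_bound (e :: E) v.
rewrite (Kcount_cons fE (vB _ (leqnSn _))) /=.
case: ifPn => [e2w|/negPn/eqP e2w].
  rewrite (Kcount_cons (B := B0.+1)) ?vB//=; last first.
    by rewrite lt12; apply/allP => x; rewrite mem_filter => /andP[_ /(allP fE')].
  by apply: eq_bigr => x _; rewrite IH// /residual /dv vw (negbTE ew) (negbTE e2w) subrr mulr0
    subrr.
rewrite big_ord_recl big1 ?addn0 => [|i _]; last first.
  apply: (Kcount_sink_gt0 (w := w)) => //.
  by rewrite lift0 /residual /dv vw (negbTE ew) e2w eqxx /=; lia.
by rewrite -IH//; apply: eq_Kcount => k; rewrite /residual mul0r subr0.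
Qed.

(** * Binomial transforms *)

(* Pascal-recursive form of sum_k 'C(c, k) * f k; see [btr_bin]. *)
Fixpoint btr (c : nat) (f : nat -> nat) : nat :=
  if c is c'.+1 then (btr c' f + btr c' (f \o S))%N else f 0%N.

Lemma eq_btr c f g : f =1 g -> btr c f = btr c g.
Proof. by move=> /funext ->. Qed.

Lemma btr_eq0 c f : (forall k, (k <= c)%N -> f k = 0%N) -> btr c f = 0%N.
Proof.
elim: c f => [|c IH] f f0 /=; first exact: f0.
by rewrite !IH// => k kc; apply: f0; rewrite ?ltnS// ltnW.
Qed.

Lemma btr_at0 c f : (forall k, f k.+1 = 0%N) -> btr c f = f 0%N.
Proof.
elim: c f => [//|c IH] f f0 /=; rewrite IH// btr_eq0 ?addn0// => k _.
exact: f0.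
Qed.

Lemma btrD c f g : btr c (fun k => f k + g k)%N = (btr c f + btr c g)%N.
Proof.
by elim: c f g => [//|c IH] f g /=; rewrite IH (IH (f \o S)) addnACA.
Qed.

Lemma btr0 c : btr c (fun=> 0%N) = 0%N.
Proof. exact: btr_eq0. Qed.

Lemma btr_sum (I : Type) (r : seq I) c (f : I -> nat -> nat) :
  btr c (fun k => \sum_(i <- r) f i k)%N = (\sum_(i <- r) btr c (f i))%N.
Proof.
elim: r => [|i r IH].
  by rewrite big_nil -[RHS](btr0 c); apply: eq_btr => k; rewrite big_nil.
by rewrite big_cons -IH -btrD; apply: eq_btr => k; rewrite big_cons.
Qed.

Lemma btrC c d (f : nat -> nat -> nat) :
  btr c (fun p => btr d (f p)) = btr d (fun q => btr c (f^~ q)).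
Proof.
elim: c f => [//|c IH] f /=; rewrite btrD IH; congr (_ + _)%N.
exact: (IH (f \o S)).
Qed.

Lemma btr_bin N c f : (forall k, (N <= k)%N -> f k = 0%N) ->
  btr c f = (\sum_(k < N) 'C(c, k) * f k)%N.
Proof.
elim: c f => [|c IH] f fN /=.
  case: N fN => [|N] fN; first by rewrite big_ord0 fN.
  by rewrite big_ord_recl big1 ?addn0 ?mul1n// => i _; rewrite lift0.
rewrite IH// IH; last by move=> k Nk; rewrite /= fN// leqW.
case: N fN {IH} => [|N] fN; first by rewrite !big_ord0.
rewrite big_ord_recl [X in (_ + X)%N]big_ord_recr /= (fN N.+1)// muln0 addn0.
rewrite [RHS]big_ord_recl !bin0 -addnA; congr (_ + _)%N.
by rewrite -big_split /=; apply: eq_bigr => i _; rewrite /bump /= !add1n binS mulnDl.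
Qed.

Definition btr2 (A B : nat) (F : nat -> nat -> nat) := btr A (fun p => btr B (F p)).

Lemma btr2Sl A B F : btr2 A.+1 B F = (btr2 A B F + btr2 A B (fun p => F p.+1))%N.
Proof. by []. Qed.

Lemma btr2Sr A B F : btr2 A B.+1 F = (btr2 A B F + btr2 A B (fun p q => F p q.+1))%N.
Proof. by rewrite /btr2 -btrD. Qed.

Lemma btr2D A B F G : btr2 A B (fun p q => F p q + G p q)%N = (btr2 A B F + btr2 A B G)%N.
Proof. by rewrite /btr2 -btrD; apply: eq_btr => p; rewrite btrD. Qed.

(* Umbrally, with X and Y the two shifts, this is the geometric sum
   sum_x (1+X)^(A-x) (1+Y)^(B+x) = (1+Y)^B ((1+X)^(A+1) - (1+Y)^(A+1)) / (X - Y). *)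
Lemma btr2_geometric A B F :
  (\sum_(x < A.+1) btr2 (A - x) (B + x) F =
   btr2 A.+1 B (fun p q => \sum_(k < p) F (p.-1 - k) (q + k)))%N.
Proof.
(* [Psi p q] is (X^p - Y^p) / (X - Y) Y^q applied to [F] at the origin. [PsiS] below reads (X - Y)
   Psi = F and drives the induction on [A]. *)
pose Psi p q := (\sum_(k < p) F (p.-1 - k) (q + k))%N.
have PsiS p q : Psi p.+1 q = (F p q + Psi p q.+1)%N.
  rewrite /Psi big_ord_recl subn0 addn0; congr (_ + _)%N.
  by apply: eq_bigr => k _; rewrite lift0 addnS addSn; congr F; case: p k => [[]//|p] k;
    rewrite subSS.
have Psi0 q : Psi 0%N q = 0%N by rewrite /Psi big_ord0.
rewrite -/Psi; elim: A B => [|A IH] B.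
  rewrite big_ord_recl big_ord0 addn0 subnn addn0 /btr2 /=.
  rewrite (eq_btr _ Psi0) btr0 add0n; apply: eq_btr => q /=.
  by rewrite PsiS Psi0 addn0.
rewrite big_ord_recl subn0 addn0.
under eq_bigr => x _ do rewrite lift0 subSS addnS -addSn.
rewrite IH [RHS]btr2Sl.
have -> : btr2 A.+1 B (fun p => Psi p.+1) = (btr2 A.+1 B F + btr2 A.+1 B (fun p q => Psi p q.+1))%N.
  by rewrite -btr2D; congr btr2; apply/funext => p; apply/funext => q; rewrite PsiS.
by rewrite btr2Sr addnCA.
Qed.

(** Vandermonde's identity: on functions of p + q the two shifts agree, and (1 + X)^s (1 + Y)^B
    becomes a single power. *)
Lemma btr_add s B f : btr2 s B (fun p q => f (q + p)%N) = btr (B + s) f.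
Proof.
elim: s f => [|s IH] f.
  by rewrite addn0 /btr2 /=; apply: eq_btr => q; rewrite addn0.
rewrite btr2Sl IH addnS /=; congr (_ + _)%N; rewrite -IH.
by congr btr2; apply/funext => p; apply/funext => q; rewrite /= addnS.
Qed.

(** * Binomial transforms in several variables *)

Definition upd (j : nat -> nat) i k : nat -> nat := fun x => if x == i then k else j x.

Lemma updC j i i' k k' : i != i' -> upd (upd j i k) i' k' = upd (upd j i' k') i k.
Proof.
move=> ii'; apply/funext => x; rewrite /upd.
by case: eqP => // ->; rewrite eq_sym (negbTE ii').
Qed.

Definition btr_at i c (F : (nat -> nat) -> nat) : (nat -> nat) -> nat :=
  fun j => btr c (fun k => F (upd j i k)).

(** For duplicate-free [s], the coordinates in [s] are summed with weights 'C(c i, j i) and the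
    others stay parameters. As a fold of commuting operators it lets any pair of coordinates be
    isolated, as the induction on edges requires. *)
Definition btrs (s : seq nat) (c : nat -> nat) (F : (nat -> nat) -> nat) :=
  foldr (fun i => btr_at i (c i)) F s.

Lemma btr_atC i i' c c' F : i != i' -> btr_at i c (btr_at i' c' F) = btr_at i' c' (btr_at i c F).
Proof.
move=> ii'; apply/funext => j; rewrite /btr_at btrC.
by apply: eq_btr => k; apply: eq_btr => k'; rewrite updC.
Qed.

Lemma btrs_at i s c c' F : i \notin s -> btr_at i c' (btrs s c F) = btrs s c (btr_at i c' F).
Proof.
elim: s => //= i' s IH; rewrite inE negb_or => /andP[ii' /IH <-].
by rewrite btr_atC.
Qed.

Lemma btrs_rem i s c F : uniq s -> i \in s ->
  btrs s c F = btrs (rem i s) c (btr_at i (c i) F).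
Proof.
elim: s => //= i' s IH /andP[i's us]; rewrite inE => /predU1P[->|iS].
  by rewrite eqxx btrs_at.
by case: eqP => [ii'|_] /=; rewrite -?IH//; rewrite ii' iS in i's.
Qed.

Lemma eq_btrs_c s c c' F : {in s, c =1 c'} -> btrs s c F = btrs s c' F.
Proof.
elim: s => //= i s IH cc'; rewrite IH ?cc' ?mem_head// => x xs.
by apply: cc'; rewrite inE xs orbT.
Qed.

Lemma btrs_sum (I : Type) (r : seq I) s c (F : I -> (nat -> nat) -> nat) j :
  btrs s c (fun j => \sum_(i <- r) F i j)%N j = (\sum_(i <- r) btrs s c (F i) j)%N.
Proof.
elim: s j => //= i s IH j; rewrite -btr_sum; apply: eq_btr => k.
exact: IH.
Qed.

Lemma upd_id j i : upd j i (j i) = j.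
Proof. by apply/funext => x; rewrite /upd; case: eqP => [->|]. Qed.

Lemma sum_upd N j i k : (i < N)%N ->
  (\sum_(x < N) upd j i k x + j i = \sum_(x < N) j x + k)%N.
Proof.
move=> iN; rewrite (bigD1 (Ordinal iN))//= [in RHS](bigD1 (Ordinal iN))//=.
rewrite (eq_bigr (fun x : 'I_N => j x)) => [|x xi]; last first.
  by rewrite /upd; case: eqP => // xE; move: xi; rewrite -val_eqE /= xE eqxx.
by rewrite /upd eqxx; set S := (\sum_(_ < _ | _) _)%N; lia.
Qed.

(** * The Lidskii formula *)

Lemma sum_Posz (I : Type) (r : seq I) (P : pred I) (F : I -> nat) :
  \sum_(i <- r | P i) (F i)%:Z = (\sum_(i <- r | P i) F i)%N%:Z.
Proof. by rewrite (big_morph Posz PoszD (erefl _)). Qed.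

(** Once the fixed coordinates use up the total [d], a positive entry in [s] pushes the sum beyond
    [d], where [F] vanishes. Only zero entries survive, each with weight 'C(c i, 0) = 1. *)
Lemma btrs_top N d s c (F : (nat -> nat) -> nat) (j : nat -> nat) : uniq s -> {in s, forall i, (i
  < N)%N} ->
  (forall j : nat -> nat, (d < \sum_(i < N) j i)%N -> F j = 0%N) ->
  {in s, forall i, j i = 0%N} -> (d <= \sum_(i < N) j i)%N ->
  btrs s c F j = F j.
Proof.
move=> + + F0; elim: s j => //= i s IH j /andP[is_ us] sN j0 dj.
have sN' : {in s, forall i, (i < N)%N} by move=> x xs; apply: sN; rewrite inE xs orbT.
have iN : (i < N)%N by apply: sN; rewrite mem_head.
have ji : j i = 0%N by apply: j0; rewrite mem_head.
have sumE k : (\sum_(x < N) upd j i k x = \sum_(x < N) j x + k)%N.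
  by rewrite -(sum_upd j k iN) ji addn0.
have rec k : btrs s c F (upd j i k) = F (upd j i k).
  apply: IH => // [x xs|]; last by rewrite sumE (leq_trans dj)// leq_addr.
  rewrite /upd; case: eqP => [xi|_]; last by apply: j0; rewrite inE xs orbT.
  by rewrite -xi xs in is_.
change (btr_at i (c i) (btrs s c F) j = F j); rewrite /btr_at btr_at0.
  by rewrite rec -{1}ji upd_id.
by move=> k; rewrite rec F0// sumE addnS ltnS (leq_trans dj)// leq_addr.
Qed.

(** No edge enters the tail of [e], so the netflow at this vertex alone limits the flow on [e],
    whatever the supply of earlier vertices. *)
Lemma Kcount_source e (E : seq edge) (v : nat -> int) (c : nat) : forward (e :: E) ->
  (forall e', e' \in E -> e'.2 != e.1) -> v e.1 < c%:Z ->
  Kcount (e :: E) v = (\sum_(x < c) Kcount E (residual v e x))%N.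
Proof.
move=> fE uE vc; have /andP[lt12 fE'] := fE.
have [B0 /(_ (maxn B0 c) (leq_maxl _ _) e (mem_head _ _)) vB] := prefix_bound (e :: E) v.
rewrite (Kcount_cons fE vB).
rewrite -!(big_mkord xpredT (fun x : nat => Kcount E (residual v e x))).
rewrite (big_cat_nat _ _ (n := c))//= ?leq_maxr// [X in (_ + X)%N]big_nat_cond [X in (_ +
  X)%N]big1 ?addn0//.
move=> x /andP[/andP[cx _] _]; apply: (Kcount_source_lt0 (w := e.1)) => //.
by rewrite /residual /dv eqxx; case: eqP lt12 => [->|_ _ /=]; rewrite ?ltnn//; lia.
Qed.

(** The sink n+1 absorbs the total of the entries at 0, ..., n, and [a n.+1] is never read. An
    update of [a] at the head of an edge is therefore correct even if that head is the sink. *)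
Definition ext n (a : nat -> nat) (k : nat) : int :=
  if (k <= n)%N then (a k)%:Z
  else if k == n.+1 then - (\sum_(i < n.+1) a i)%N%:Z else 0.

Definition demand (E : seq edge) (j : nat -> nat) (k : nat) : int :=
  (j k)%:Z - (outm E k)%:Z.

Lemma residual_ext n a e x : (e.1 < e.2)%N -> (e.2 <= n.+1)%N -> (x <= a e.1)%N ->
  residual (ext n a) e x = ext n (upd (upd a e.1 (a e.1 - x)%N) e.2 (a e.2 + x)%N).
Proof.
move=> lt12 le2 xa; have le1 : (e.1 < n.+1)%N by apply: leq_trans lt12 le2.
have ne : e.2 != e.1 by rewrite neq_ltn lt12 orbT.
set a1 := upd a _ _; set a2 := upd a1 _ _.
have S1 : (\sum_(i < n.+1) a1 i + x = \sum_(i < n.+1) a i)%N.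
  by have := sum_upd a (a e.1 - x) le1; rewrite -/a1; lia.
have a1v : a1 e.2 = a e.2 by rewrite /a1 /upd (negbTE ne).
have S2 : (\sum_(i < n.+1) a2 i = \sum_(i < n.+1) a1 i + (e.2 <= n) * x)%N.
  case: (leqP e.2 n) => le; last first.
    rewrite mul0n addn0; apply: eq_bigr => i _; rewrite /a2 /upd.
    by case: eqP => // ie; move: le (ltn_ord i); rewrite -ie ltnNge => /negP.
  by have := sum_upd a1 (a e.2 + x) (le : (e.2 < n.+1)%N); rewrite -/a2 a1v mul1n; lia.
apply/funext => k; rewrite /residual /ext /dv.
case: leqP => kn.
  rewrite /a2 /a1 /upd ![k == _]eq_sym.
  case: (e.2 =P k) => [k2|k2].
    by rewrite -k2 eq_sym (negbTE ne) /=; lia.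
  by case: (e.1 =P k) => [k1|k1] /=; rewrite -?k1; lia.
have k1 : (e.1 == k) = false by apply/negbTE; rewrite neq_ltn (leq_trans le1 kn).
rewrite k1; case: (k =P n.+1) => [->|kn1].
  by move: S1 S2; case: (e.2 =P n.+1) => e2n /=; lia.
by case: (e.2 =P k) => [ek|] /=; lia.
Qed.

Section LidskiiStep.
Variables (n : nat) (e : edge) (E : seq edge) (a : nat -> nat).
Hypothesis fE : forward (e :: E).
Hypothesis tailE : forall e', e' \in E -> (e.1 <= e'.1)%N.
Hypothesis len : (e.2 <= n.+1)%N.

Let u := e.1.
Let v := e.2.
Let rest := rem v (rem u (iota 0 n.+2)).
Let Phi j p q := Kcount E (demand E (upd (upd j u p) v q)).

Let ltuv : (u < v)%N. Proof. by case/andP: fE. Qed.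
Let fE' : forward E. Proof. by case/andP: fE. Qed.
Let neuv : u != v. Proof. by rewrite neq_ltn ltuv. Qed.
Let headE e' : e' \in E -> e'.2 != u.
Proof.
move=> e'E; rewrite neq_ltn; apply/orP; right; apply: leq_ltn_trans (tailE e'E) _.
exact: (allP fE').
Qed.

Let uniq_iota := iota_uniq 0 n.+2.
Let uin : u \in iota 0 n.+2. Proof. by rewrite mem_iota; have := ltuv; rewrite /v; lia. Qed.
Let vin : v \in rem u (iota 0 n.+2).
Proof. by rewrite (mem_rem_uniq _ uniq_iota) inE eq_sym neuv mem_iota /=; rewrite /v; lia. Qed.

Lemma btrs_split c F : btrs (iota 0 n.+2) c F = btrs rest c (btr_at v (c v) (btr_at u (c u) F)).
Proof. by rewrite (btrs_rem _ _ _ uin)// (btrs_rem _ _ _ vin)// rem_uniq. Qed.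

Lemma btrs_split_Phi c : btrs (iota 0 n.+2) c (fun j => Kcount E (demand E j)) =
  btrs rest c (fun j => btr2 (c u) (c v) (Phi j)).
Proof. by rewrite btrs_split btr_atC// eq_sym. Qed.

Lemma mem_rest i : i \in rest -> (i != u) && (i != v).
Proof. by rewrite /rest mem_rem_uniq ?rem_uniq// inE mem_rem_uniq// inE => /and3P[-> ->]. Qed.

Lemma outm_cons_neq i : i != u -> outm (e :: E) i = outm E i.
Proof. by rewrite /outm /outdeg /= eq_sym -/u => /negbTE ->. Qed.

Lemma Phi_lt p q j : (p < outm E u)%N -> Phi j p q = 0%N.
Proof.
move=> pu; apply: (Kcount_source_lt0 (w := u)) => //.
by rewrite /demand /upd (negbTE neuv) eqxx; lia.
Qed.

Lemma residual_demand j p q k : (k <= p)%N ->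
  residual (demand E (upd (upd j u p) v q)) e k = demand E (upd (upd j u (p - k)%N) v (q + k)%N).
Proof.
move=> kp; apply/funext => i; rewrite /residual /demand /dv /upd -/u -/v ![_ == i]eq_sym.
case: (i =P v) => [->|_]; first by rewrite eq_sym (negbTE neuv) /=; lia.
by case: (i =P u) => _ /=; lia.
Qed.

(** A further outgoing edge raises out_u by one, so the supply p at u becomes p - 1 relative to [E]:
    this is the origin of [p.-1]. The result has the shape of the right side of [btr2_geometric]. *)
Lemma demand_step : (0 < outdeg E u)%N -> forall j p q,
  Kcount (e :: E) (demand (e :: E) (upd (upd j u p) v q)) =
  (\sum_(k < p) Phi j (p.-1 - k) (q + k))%N.
Proof.
move=> du j p q; have ou : outm (e :: E) u = (outm E u).+1.
  by rewrite /outm /outdeg /= eqxx add1n /= prednK.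
rewrite (Kcount_source (c := p) fE)//; last first.
  by rewrite /demand /upd (negbTE neuv) eqxx ou; lia.
apply: eq_bigr => k _; apply: eq_Kcount => i.
have kp : (k <= p.-1)%N by have := ltn_ord k; lia.
rewrite -residual_demand// /residual /demand; have [->|iu] := eqVneq i u.
  rewrite ou /upd (negbTE neuv) eqxx; have := ltn_ord k; lia.
by rewrite outm_cons_neq// /upd (negbTE iu).
Qed.

(** Here [e] is the only edge out of u, and [outm] at u is 0 both with and without it. Without [e]
    the vertex u is isolated, so all p units are forced through [e]. *)
Lemma demand_step0 : outdeg E u = 0%N -> forall j p q,
  Kcount (e :: E) (demand (e :: E) (upd (upd j u p) v q)) = Phi j 0 (q + p).
Proof.
move=> du j p q; have ou : outm (e :: E) u = 0%N.
  by rewrite /outm /outdeg /= eqxx add1n /=.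
have ou' : outm E u = 0%N by rewrite /outm du.
have dE : demand (e :: E) = demand E.
  apply/funext => f; apply/funext => i; rewrite /demand.
  by have [->|iu] := eqVneq i u; rewrite ?ou ?ou' ?outm_cons_neq.
have noE e' : e' \in E -> (e'.1 != u) && (e'.2 != u).
  move=> e'E; rewrite headE// andbT; apply/negP => e'u.
  by move: du; apply/eqP; rewrite -lt0n /outdeg -has_count; apply/hasP; exists e'.
rewrite (Kcount_source (c := p.+1) fE)//; last first.
  by rewrite /demand /upd (negbTE neuv) eqxx ou; lia.
rewrite big_ord_recr big1 /= => [|k _]; last first.
  apply: (Kcount_isolated (w := u)) => //.
  rewrite dE residual_demand ?(ltnW (ltn_ord k))// /demand /upd (negbTE neuv) eqxx ou'.
  have := ltn_ord k; lia.
by rewrite add0n dE residual_demand// subnn.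
Qed.

Hypothesis IH : forall a', (forall i, (i <= n)%N -> outdeg E i = 0%N -> a' i = 0%N) ->
  Kcount E (ext n a') =
  btrs (iota 0 n.+2) (fun i => (a' i + outm E i)%N) (fun j => Kcount E (demand E j)) (fun=> 0%N).
Hypothesis vE : (v <= n)%N -> (0 < outdeg E v)%N.
Hypothesis a0 : forall i, (i <= n)%N -> outdeg (e :: E) i = 0%N -> a i = 0%N.

Let ax x := upd (upd a u (a u - x)%N) v (a v + x)%N.

(** The induction hypothesis wants netflow 0 at vertices without outgoing edges; u qualifies either
    because it keeps an edge or because all a_u units have left it. *)
Lemma IH_ax x : (0 < outdeg E u)%N || (x == a u) -> (x <= a u)%N ->
  Kcount E (ext n (ax x)) = btrs rest (fun i => a i + outm (e :: E) i)%N
    (fun j => btr2 (a u - x + outm E u) (a v + outm E v + x) (Phi j)) (fun=> 0%N).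
Proof.
move=> du xa; rewrite IH => [|i ile di].
  rewrite btrs_split_Phi.
  have -> : ax x u = (a u - x)%N by rewrite /ax /upd (negbTE neuv) eqxx.
  have -> : ax x v = (a v + x)%N by rewrite /ax /upd eqxx.
  rewrite addnAC; apply: (congr1 (@^~ _)); apply: eq_btrs_c => i /mem_rest /andP[iu iv].
  by rewrite /ax /upd (negbTE iu) (negbTE iv) outm_cons_neq.
rewrite /ax /upd; case: eqP => [iv|_]; first by move: vE; rewrite -iv di => /(_ ile).
case: (i =P u) => [iu|iu]; first by move: du; rewrite -iu di /= => /eqP ->; rewrite iu subnn.
by apply: a0 => //; rewrite /outdeg /= -/u eq_sym; case: eqP iu.
Qed.

Lemma lidskii_step : Kcount (e :: E) (ext n a) =
  btrs (iota 0 n.+2) (fun i => (a i + outm (e :: E) i)%N)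
    (fun j => Kcount (e :: E) (demand (e :: E) j)) (fun=> 0%N).
Proof.
have leun : (u <= n)%N by have := ltuv; rewrite /v; lia.
rewrite (Kcount_source (c := (a u).+1) fE)//; last by rewrite /ext -/u leun; lia.
rewrite (eq_bigr (fun x : 'I_(a u).+1 => Kcount E (ext n (ax x)))); last first.
  by move=> x _; rewrite residual_ext// -ltnS.
rewrite btrs_split btr_atC 1?eq_sym//.
have ov : outm (e :: E) v = outm E v by rewrite outm_cons_neq// eq_sym.
rewrite ov; have [du|] := posnP (outdeg E u).
  rewrite big_ord_recr big1 /= => [|x _]; last first.
    apply: (Kcount_isolated (w := u)) => //.
      move=> e' e'E; rewrite headE// andbT; apply/negP => e'u.
      by move: du; apply/eqP; rewrite -lt0n /outdeg -has_count; apply/hasP; exists e'.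
    rewrite /ext leun /ax /upd (negbTE neuv) eqxx; have := ltn_ord x; lia.
  have ou : outm (e :: E) u = 0%N by rewrite /outm /outdeg /= eqxx add1n.
  have ou' : outm E u = 0%N by rewrite /outm du.
  rewrite add0n (@IH_ax (a u)); [|by rewrite eqxx orbT|by []].
  rewrite subnn ou' ou !addn0.
  apply: (congr1 (fun F => btrs rest _ F _)); apply/funext => j.
  rewrite /btr_at.
  transitivity (btr2 (a u) (a v + outm E v) (fun p q => Phi j 0 (q + p))).
    by rewrite btr_add.
  by congr btr2; apply/funext => p; apply/funext => q; rewrite demand_step0.
move=> du; have ou : outm (e :: E) u = (outm E u).+1.
  by rewrite /outm /outdeg /= eqxx add1n /= prednK.
rewrite ou addnS.
rewrite (eq_bigr (fun x : 'I_(a u).+1 => btrs rest (fun i => a i + outm (e :: E) i)%N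
    (fun j => btr2 (a u + outm E u - x) (a v + outm E v + x) (Phi j)) (fun=> 0%N))); last first.
  move=> x _; have xa : (x <= a u)%N by rewrite -ltnS.
  by rewrite IH_ax ?du// addnBAC.
rewrite -(btrs_sum _ _ _ (fun (x : 'I_(a u).+1) j => btr2 (a u + outm E u - x) (a v + outm E v +
  x) (Phi j))).
apply: (congr1 (fun F => btrs rest _ F _)); apply/funext => j.
(* The geometric identity needs x to run up to a_u + out_u, with out_u taken in [E]. For x > a_u the
   transform in p reaches only exponents below out_u, where [Phi] vanishes. *)
transitivity (\sum_(x < (a u + outm E u).+1) btr2 (a u + outm E u - x) (a v + outm E v + x) (Phi
  j))%N.
  rewrite -!(big_mkord xpredT (fun x => btr2 (a u + outm E u - x) (a v + outm E v + x) (Phi j))).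
  rewrite [RHS](big_cat_nat _ _ (n := (a u).+1))//= ?ltnS ?leq_addr//.
  rewrite [X in _ = (_ + X)%N]big_nat_cond [X in _ = (_ + X)%N]big1 ?addn0//.
  move=> x /andP[/andP[ax_ xA] _]; apply: btr_eq0 => p pA; apply: btr_eq0 => q _.
  by apply: Phi_lt; lia.
rewrite btr2_geometric; congr btr2; apply/funext => p; apply/funext => q.
by rewrite demand_step.
Qed.

End LidskiiStep.

(* The Lidskii formula of Baldoni and Vergne:
   K_G(a) = sum_j prod_i binom(a_i + out_i, j_i) K_G(j - out). *)
Lemma lidskii n (E : seq edge) (a : nat -> nat) : forward E ->
  sorted (fun e e' : edge => e.1 <= e'.1)%N E ->
  (forall e, e \in E -> (e.2 <= n.+1)%N) ->
  (forall e, e \in E -> (e.2 <= n)%N -> (0 < outdeg E e.2)%N) ->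
  (forall i, (i <= n)%N -> outdeg E i = 0%N -> a i = 0%N) ->
  Kcount E (ext n a) =
  btrs (iota 0 n.+2) (fun i => (a i + outm E i)%N) (fun j => Kcount E (demand E j)) (fun=> 0%N).
Proof.
elim: E a => [|e E IH] a fE sE hE cE a0.
  rewrite (btrs_top (N := n.+2) (d := 0)) ?iota_uniq//.
  - apply: eq_Kcount => k; rewrite /ext /demand /outm /= big1 ?oppr0 ?if_same => [|i _].
      by case: leqP => // kn; rewrite a0.
    by rewrite a0// -ltnS.
  - by move=> i; rewrite mem_iota.
  - move=> j jgt0; apply: (Kcount_prefix_neq0 (N := n.+2)) => //.
    rewrite /demand /outm /=; under eq_bigr do rewrite subr0.
    by rewrite sum_Posz eqz_nat -lt0n.
have /allP tE : all (fun e' : edge => e.1 <= e'.1)%N E.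
  by apply: order_path_min sE => x y z; apply: leq_trans.
have fE' : forward E by case/andP: fE.
(* Dropping [e] lowers only the outdegree of its tail, which is minimal among all tails and hence
   the head of no edge. *)
have outE e' : e' \in e :: E -> (e'.2 <= n)%N -> (0 < outdeg E e'.2)%N.
  move=> e'E /(cE _ e'E); rewrite {1}/outdeg /=.
  suff -> : (e.1 == e'.2) = false by [].
  apply/negbTE; rewrite neq_ltn; apply/orP; left.
  move: e'E; rewrite inE => /predU1P[->|e'E]; first by case/andP: fE.
  by apply: leq_ltn_trans (tE _ e'E) _; apply: (allP fE').
apply: lidskii_step => //; rewrite ?hE ?mem_head//.
  move=> a' a'0; apply: IH => //.
  - exact: path_sorted sE.
  - by move=> e' e'E; apply: hE; rewrite inE e'E orbT.
  - by move=> e' e'E; apply: outE; rewrite inE e'E orbT.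
by apply: outE; rewrite mem_head.
Qed.

(** * Growth of the number of grid points *)

(** [G k] is the part of the Lidskii sum with j_0 = k. The netflow vanishes at 1, ..., n, so the
    remaining weights are 'C(out_i, j_i) and do not involve t. *)
Lemma Kcount_srcsink n (H : seq edge) : forward H ->
  (forall e, e \in H -> (e.2 <= n.+1)%N) ->
  (forall k, (k <= n)%N -> (0 < outdeg H k)%N) ->
  let d := (\sum_(i < n.+2) outm H i)%N in
  exists G : nat -> nat,
    [/\ forall t : nat, Kcount H (fun k => t%:Z * srcsink n k) = btr (t + outm H 0) G,
        forall k, (d < k)%N -> G k = 0%N &
        G d = Kcount H (demand H (upd (fun=> 0%N) 0 d))].
Proof.
move=> fH hH oH d; set leT := fun e e' : edge => (e.1 <= e'.1)%N.
set H' := sort leT H.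
have pH : perm_eq H H' by rewrite perm_sym perm_sort.
have oE : outm H' = outm H.
  by apply/funext => k; rewrite /outm /outdeg (permP pH).
have fH' : forward H' by rewrite /forward -(perm_all _ pH).
have sH' : sorted leT H' by apply: sort_sorted => x y; apply: leq_total.
have lid a : Kcount H (ext n a) =
    btrs (iota 0 n.+2) (fun i => a i + outm H i)%N (fun j => Kcount H (demand H j)) (fun=> 0%N).
  rewrite (Kcount_perm _ fH pH) lidskii//.
  - rewrite oE; congr btrs; apply/funext => j; rewrite (Kcount_perm _ fH pH).
    by apply: eq_Kcount => k; rewrite /demand oE.
  - by move=> e; rewrite -(perm_mem pH); apply: hH.
  - by move=> e _ en; rewrite /outdeg -(permP pH); apply: oH.
  - by move=> i /oH; rewrite /outdeg (permP pH) => /[swap] ->.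
pose F j := Kcount H (demand H j).
have F0 (j : nat -> nat) : (d < \sum_(i < n.+2) j i)%N -> F j = 0%N.
  move=> dj; apply: (Kcount_prefix_neq0 (N := n.+2)) => //.
    by move=> e /hH; rewrite -ltnS => ->; rewrite orbT.
  by rewrite sumrB !sum_Posz subr_eq0 eqz_nat -/d neq_ltn dj orbT.
pose z : nat -> nat := fun=> 0%N.
have sumz k : (\sum_(i < n.+2) upd z 0 k i)%N = k.
  by have := sum_upd z k (ltn0Sn n.+1); rewrite /z sum_nat_const muln0 add0n addn0.
have top k : (d <= k)%N -> btrs (iota 1 n.+1) (outm H) F (upd z 0 k) = F (upd z 0 k).
  move=> dk; apply: (btrs_top (N := n.+2) (d := d)) => //; rewrite ?iota_uniq ?sumz//.
    by move=> i; rewrite mem_iota => /andP[].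
  by move=> i; rewrite mem_iota => /andP[i0 _]; rewrite /upd gtn_eqF.
exists (fun k => btrs (iota 1 n.+1) (outm H) F (upd z 0 k)); split.
- move=> t; pose a := upd z 0 t.
  rewrite (_ : (fun k => t%:Z * srcsink n k) = ext n a).
    rewrite lid.
    change (btr (t + outm H 0) (fun k => btrs (iota 1 n.+1) (fun i => a i + outm H i)%N F (upd z
      0 k)) =
            btr (t + outm H 0) (fun k => btrs (iota 1 n.+1) (outm H) F (upd z 0 k))).
    apply: eq_btr => k; apply: (congr1 (@^~ _)); apply: eq_btrs_c => i.
    by rewrite mem_iota => /andP[i0 _]; rewrite /a /upd gtn_eqF.
  apply/funext => k; rewrite /ext /srcsink /a; case: k => [|k]; first by rewrite mulr1.
  rewrite /= eqSS; have [kn|kn] := ltnP k n; first by rewrite (ltn_eqF kn) mulr0.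
  case: eqP => [_|_]; last by rewrite mulr0.
  have := sum_upd z t (ltn0Sn n); rewrite {2 3}/z sum_nat_const muln0 add0n addn0 => ->.
  by rewrite mulrN1.
- by move=> k dk; rewrite top 1?ltnW// F0// sumz.
- by rewrite top.
Qed.

(** * Asymptotics of binomial coefficients and their combinations *)

Section Limit.
Variable R : realType.

Lemma cvg_inv_nat : (fun t : nat => (t%:R : R)^-1) @ \oo --> (0 : R).
Proof. by rewrite -cvg_shiftS; exact: cvg_harmonic. Qed.

Lemma cvg_bin c k :
  (fun t : nat => 'C(t + c, k)%:R / t%:R ^+ k : R) @ \oo --> ((k`!)%:R^-1 : R).
Proof.
elim: k => [|k IH].
  under eq_fun do rewrite bin0 expr0 divr1.
  by rewrite invr1; exact: cvg_cst.
(* The new factor is (t + c - k) / (t (k + 1)), from the recursion (k + 1) 'C(t + c, k + 1) = (t + c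
   - k) 'C(t + c, k); it tends to 1 / (k + 1). *)
pose g (t : nat) : R := ('C(t + c, k)%:R / t%:R ^+ k) * ((1 + (c%:R - k%:R) * t%:R^-1) *
  k.+1%:R^-1).
apply: (@cvg_trans _ (g @ \oo)).
  apply: near_eq_cvg; near=> t.
  have kt : (k < t)%N by near: t; exact: nbhs_infty_gt.
  have t0 : (t%:R : R) != 0 by rewrite pnatr_eq0 -lt0n (leq_ltn_trans _ kt).
  have k0 : (k.+1%:R : R) != 0 by rewrite pnatr_eq0.
  have bE : k.+1%:R * 'C(t + c, k.+1)%:R = (t%:R + c%:R - k%:R) * 'C(t + c, k)%:R :> R.
    rewrite -natrM mul_bin_left natrM natrB ?natrD//.
    by rewrite (leq_trans (ltnW kt))// leq_addr.
  rewrite /g exprS; apply: (mulfI k0); rewrite mulrA [RHS]mulrA bE.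
  by field; rewrite expf_neq0// t0 -natr1 addrC in k0 *.
rewrite factS natrM invfM mulrC; apply: cvgM => //.
rewrite -[X in _ --> X]mul1r; apply: cvgMr_tmp.
rewrite -[X in _ --> X]addr0; apply: cvgD; first exact: cvg_cst.
rewrite -(mulr0 (c%:R - k%:R)); apply: cvgMl_tmp; exact: cvg_inv_nat.
Unshelve. all: by end_near. Qed.

Lemma cvg_bin_lt c k d : (k < d)%N ->
  (fun t : nat => 'C(t + c, k)%:R / t%:R ^+ d : R) @ \oo --> (0 : R).
Proof.
move=> kd; pose g (t : nat) : R := ('C(t + c, k)%:R / t%:R ^+ k) * (t%:R^-1) ^+ (d - k).
apply: (@cvg_trans _ (g @ \oo)).
  apply: near_eq_cvg; near=> t; rewrite /g -mulrA -exprVn -exprVn -exprD subnKC//.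
  exact: ltnW.
rewrite -(mulr0 ((k`!)%:R^-1)); apply: cvgM; first exact: cvg_bin.
have -> : (0 : R) = 0 ^+ (d - k) by rewrite expr0n subn_eq0 leqNgt kd.
elim: (d - k)%N => [|m IH]; first by rewrite expr0; exact: cvg_cst.
under eq_fun do rewrite exprS.
by rewrite exprS; apply: cvgM => //; exact: cvg_inv_nat.
Unshelve. all: by end_near. Qed.

Lemma cvg_btr c d (G : nat -> nat) : (forall k, (d < k)%N -> G k = 0%N) ->
  (fun t : nat => (btr (t + c) G)%:R / t%:R ^+ d : R) @ \oo --> ((G d)%:R / (d`!)%:R : R).
Proof.
move=> G0; under eq_fun do rewrite (btr_bin (N := d.+1))// natr_sum mulr_suml.
under eq_fun => t do under eq_bigr do rewrite natrM mulrAC.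
pose l k : R := (if k == d then (d`!)%:R^-1 else 0) * (G k)%:R.
have -> : (G d)%:R / (d`!)%:R = \sum_(k < d.+1) l k :> R.
  rewrite big_ord_recr /= big1 => [|k _]; last by rewrite /l ltn_eqF// mul0r.
  by rewrite add0r /l eqxx mulrC.
apply: cvg_big => [|k _]; first exact: add_continuous.
apply: cvgMr_tmp; case: eqP => [->|kd]; first exact: cvg_bin.
apply: cvg_bin_lt; have := ltn_ord k; lia.
Qed.

End Limit.

Lemma flow_polytope_scaled (R : realType) (E : seq edge) (v : nat -> int) (t : nat)
    (g : {ffun 'I_(size E) -> int}) : (0 < t)%N ->
  flow_polytope R E v (\row_e ((g e)%:~R / t%:R)) <-> is_flow (fun k => t%:Z * v k) g.
Proof.
move=> t0; have tR : 0 < (t%:R : R) by rewrite ltr0n.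
have nE k : netflow E (fun e => (\row_e0 ((g e0)%:~R / (t%:R : R))) ord0 e) k = (netflow E g
  k)%:~R / t%:R.
  rewrite !netflowE rmorph_sum /= mulr_suml; apply: eq_bigr => i _.
  by rewrite mxE rmorphM /= intz mulrAC.
rewrite /flow_polytope /is_flow /=; split=> -[g0 gv]; split.
- by move=> e; have := g0 e; rewrite mxE pmulr_lge0 ?invr_gt0// ler0z.
- move=> k; have := gv k; rewrite nE => /(canRL (divfK (lt0r_neq0 tR))) => nk.
  by apply/eqP; rewrite -(eqr_int R) nk rmorphM /= mulrC.
- by move=> e; rewrite mxE pmulr_lge0 ?invr_gt0// ler0z.
- by move=> k; rewrite nE gv rmorphM /= mulrAC mulfV ?mul1r// lt0r_neq0.
Qed.

Lemma lattice_points_flow (R : realType) (E : seq edge) (v : nat -> int) :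
  lattice_points (flow_polytope R E v) = Kcount E v.
Proof.
rewrite /lattice_points /Kcount; congr (#|` fset_set _|).
apply/seteqP; split => g /=; rewrite -/(is_flow v g).
  rewrite (_ : \row__ _ = \row_e ((g e)%:~R / 1%:R)); last by apply/rowP => e; rewrite !mxE divr1.
  move/(flow_polytope_scaled R v g (ltn0Sn 0)) => [g0 gv]; split=> // k.
  by rewrite gv mul1r.
move=> [g0 gv]; rewrite (_ : \row__ _ = \row_e ((g e)%:~R / 1%:R)); last by apply/rowP => e;
  rewrite !mxE divr1.
by apply/(flow_polytope_scaled R v g (ltn0Sn 0)); split=> // k; rewrite gv mul1r.
Qed.

Lemma grid_count_flow (R : realType) (E : seq edge) (v : nat -> int) t : (0 < t)%N ->
  grid_count (flow_polytope R E v) t = Kcount E (fun k => t%:Z * v k).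
Proof.
move=> t0; rewrite /grid_count /Kcount; congr (#|` fset_set _|).
by apply/seteqP; split => g /=; rewrite -/(is_flow _ g) flow_polytope_scaled.
Qed.

(** * Dimension of flow polytopes *)

Section AffineDim.
Variables (R : realType) (n : nat) (H : seq edge).
Hypothesis fH : forward H.
Hypothesis headH : forall e, e \in H -> (e.2 <= n.+1)%N.
Hypothesis outH : forall k, (k <= n)%N -> (0 < outdeg H k)%N.

Lemma mem_ethe (i : 'I_(size H)) : ethe i \in H.
Proof. exact: mem_nth. Qed.

Lemma netflow_total (f : 'I_(size H) -> R) : \sum_(k < n.+2) netflow H f k = 0.
Proof.
under eq_bigr do rewrite netflowE.
rewrite exchange_big big1 //= => i _.
rewrite -mulr_sumr -rmorph_sum sum_dv ?(allP fH) ?mem_ethe//.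
by rewrite [(n.+1 < _)%N]ltnNge headH ?mem_ethe// andbF mulr0.
Qed.

(** All edges stay within 0, ..., n+1, so the netflows sum to 0 and the equation at the sink follows
    from the others. Hence [incidence] has only n+1 columns. *)
Lemma netflow_extend (f : 'I_(size H) -> R) (v : nat -> R) :
  (forall k, (k <= n)%N -> netflow H f k = v k) ->
  v n.+1 = - \sum_(k < n.+1) v k -> (forall k, (n.+1 < k)%N -> v k = 0) ->
  forall k, netflow H f k = v k.
Proof.
move=> vle vn vgt k; have [/vle//|nk|->] := ltngtP k n.+1.
  rewrite vgt// netflowE big1// => i _; rewrite /dv.
  have h1 := headH (mem_ethe i); have h2 := allP fH _ (mem_ethe i).
  by rewrite !ltn_eqF ?subrr ?mulr0 ?(leq_ltn_trans h1 nk)// (ltn_trans h2)// (leq_ltn_trans h1 nk).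
apply/eqP; rewrite vn -addr_eq0 addrC; apply/eqP; rewrite -[RHS](netflow_total f).
rewrite [RHS]big_ord_recr /=; congr (_ + _); apply: eq_bigr => i _.
by rewrite vle// -ltnS.
Qed.

Definition incidence : 'M[R]_(size H, n.+1) := \matrix_(e, k) (dv (ethe e) k)%:~R.

Lemma mul_incidence m (A : 'M[R]_(m, size H)) i k :
  (A *m incidence) i k = netflow H (fun e => A i e) k.
Proof. by rewrite mxE netflowE; apply: eq_bigr => e _; rewrite mxE. Qed.

(** A linear relation among the columns is a potential on the vertices, 0 at the sink and equal at
    both ends of every edge. Outgoing edges lead from each vertex to the sink, so it is 0
    everywhere. *)
Lemma rank_incidence : \rank incidence = n.+1.
Proof.
rewrite -mxrank_tr; apply/eqP; apply: inj_row_free => w w0.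
pose W k : R := if (k < n.+1)%N then w ord0 (inord k) else 0.
have WE e : e \in H -> W e.1 = W e.2.
  move=> eH; have lt12 := allP fH _ eH; have h2 := headH eH.
  have /rowP/(_ (Ordinal (etrans (index_mem e H) eH))) := w0; rewrite !mxE.
  under eq_bigr => k _ do rewrite !mxE /ethe /= nth_index// rmorphB /= mulrBr.
  have sumE (x : nat) : \sum_(k < n.+1) w ord0 k * ((x == k)%:R : R) = W x.
    rewrite /W; case: ltnP => xn.
      rewrite (bigD1 (inord x))//= inordK// eqxx mulr1 big1 ?addr0// => k kx.
      case: eqP => xk; rewrite ?mulr0//; case/eqP: kx.
      by apply/val_inj; rewrite /= inordK.
    by rewrite big1// => k _; rewrite gtn_eqF ?mulr0// (leq_trans (ltn_ord k)).
  by rewrite sumrB !sumE => /eqP; rewrite subr_eq0 => /eqP.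
have W0 m k : (n.+1 - k <= m)%N -> W k = 0.
  elim: m k => [|m IH] k km; first by rewrite /W ltnNge -subn_eq0 -leqn0 km.
  rewrite /W; case: ltnP => // kn.
  have /outH : (k <= n)%N by lia.
  rewrite /outdeg -has_count => /hasP[e eH /eqP ek].
  have := WE e eH; rewrite (IH e.2); last first.
    by rewrite -ltnS (leq_trans _ km)// ltn_sub2l// -ek; exact: (allP fH _ eH).
  by rewrite ek /W kn.
apply/rowP => k; rewrite mxE -(W0 n.+1 k (leq_subr _ _)) /W ltn_ord.
by rewrite inord_val.
Qed.

(** Differences of points lie in the kernel of the incidence matrix, which bounds the dimension.
    Conversely, a flow positive on every edge can be moved a little along each vector of a basis of
    this kernel. *)
Lemma affine_dim_flow (v : nat -> int) (f0 : 'rV[R]_(size H)) :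
  flow_polytope R H v f0 -> (forall e, 0 < f0 ord0 e) ->
  affine_dim (flow_polytope R H v) (size H - n.+1).
Proof.
move=> f0P f0gt0; have [_ f0v] := f0P.
have <- : \rank (kermx incidence) = (size H - n.+1)%N by rewrite mxrank_ker rank_incidence.
set d := \rank (kermx incidence); split; last first.
  move=> k ps psP; apply: mxrankS; apply/sub_kermxP/matrixP => i j.
  rewrite mul_incidence [RHS]mxE netflowE.
  under eq_bigr do rewrite mxE mulrBl.
  have nE i' : \sum_(x < size H) ps i' x * (dv (ethe x) j)%:~R = (v j)%:~R.
    have [_ /(_ j) <-] := psP i'; rewrite netflowE.
    by apply: eq_bigr => e _; rewrite mxE.
  by rewrite sumrB !nE subrr.
have [B [Bker Bfree]] : exists B : 'M_(d, size H), B *m incidence = 0 /\ \rank B = d.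
  by exists (row_base (kermx incidence)); split; [apply/sub_kermxP|]; rewrite eq_row_base.
(* [s] exceeds every ratio |B i j| / f0 j, so f0 plus a row of B divided by [s] stays nonnegative;
   the summand 1 makes [s] positive. *)
pose s : R := 1 + \sum_i \sum_j `|B i j| / f0 ord0 j.
have c0 i j : 0 <= `|B i j| / f0 ord0 j by rewrite divr_ge0// ltW.
have s1 : 1 <= s by rewrite lerDl sumr_ge0// => i _; rewrite sumr_ge0.
have s0 : 0 < s by apply: lt_le_trans s1.
have Bs i j : `|B i j| / f0 ord0 j <= s.
  apply: (@le_trans _ _ (\sum_j `|B i j| / f0 ord0 j)).
    by rewrite (bigD1 j)//= lerDl sumr_ge0.
  apply: (@le_trans _ _ (\sum_i \sum_j `|B i j| / f0 ord0 j)); last by rewrite lerDr.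
  by rewrite [leRHS](bigD1 i)//= lerDl sumr_ge0// => i' _; rewrite sumr_ge0.
pose ps : 'M[R]_(d.+1, size H) :=
  \matrix_(i, j) (f0 ord0 j + if unlift ord0 i is Some i' then s^-1 * B i' j else 0).
exists ps; split.
  move=> i; split=> [e|k].
    rewrite !mxE; case: unliftP => [i' _|_]; last by rewrite addr0 ltW.
    rewrite -lerBlDl sub0r lerNl (le_trans (ler_norm _))// normrN normrM.
    rewrite gtr0_norm ?invr_gt0// mulrC ler_pdivrMr// mulrC.
    by rewrite -ler_pdivrMr.
  rewrite -f0v !netflowE; apply/eqP; rewrite -subr_eq0 -sumrB; apply/eqP.
  under eq_bigr => e _ do rewrite !mxE -mulrBl addrC addKr.
  case: unliftP => [i' _|_]; last by rewrite big1// => e _; rewrite mul0r.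
  under eq_bigr do rewrite -mulrA.
  rewrite -mulr_sumr -netflowE.
  rewrite (netflow_extend (v := fun=> 0)) ?mulr0//; last by rewrite big1 ?oppr0.
  move=> k' k'n; have := @mul_incidence _ B i' (Ordinal (k'n : (k' < n.+1)%N)) => /= <-.
  by rewrite Bker mxE.
have -> : diffs ps = s^-1 *: B.
  by apply/matrixP => i j; rewrite !mxE unlift_none liftK addr0 addrC addKr.
by rewrite mxrank_scale_nz// invr_neq0// gt_eqF.
Qed.

End AffineDim.

(** [Gstar n E] is [star n E] and [Gcirc n E] is [star n.+1 E], so both volumes are computed at
    once, for n <= r <= n+1. *)
Definition star (r : nat) (E : seq edge) : seq edge := [seq (0%N, i) | i <- iota 1 r] ++ E.

Lemma netflow_edges (R : pzRingType) (H : seq edge) (F : edge -> R) k :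
  netflow H (fun i => F (ethe i)) k =
  \sum_(e <- H | e.1 == k) F e - \sum_(e <- H | e.2 == k) F e.
Proof. by rewrite /netflow !(big_nth (0%N, 0%N)) !big_mkord. Qed.

(** * A unit flow from 0 to n+1 that is positive on every edge *)

Section PositiveFlow.
Variables (R : realType) (n r : nat) (E : seq edge).
Hypothesis n0 : (0 < n)%N.
Hypothesis nr : (n <= r <= n.+1)%N.
Hypothesis edgeE : forall e, e \in E -> [&& (1 <= e.1)%N, (e.1 < e.2)%N & (e.2 <= n.+1)%N].
Hypothesis outE : forall k, (1 <= k <= n)%N -> has (fun e : edge => e.1 == k) E.

Let M := (size E).+1.
Let w (e : edge) := (M ^ e.1)%N.

(** With M = |E| + 1, one outgoing edge of k, of weight M^k, outweighs at most |E| incoming ones of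
    weight at most M^(k-1). *)
Lemma inflow_lt_outflow k : (1 <= k <= n)%N ->
  (\sum_(e <- E | e.2 == k) w e < \sum_(e <- E | e.1 == k) w e)%N.
Proof.
move=> kn; apply: (@leq_trans (M ^ k)); last first.
  have /hasP[e eE /eqP ek] := outE kn.
  by rewrite (big_rem e)//= ek eqxx /w ek leq_addr.
apply: (@leq_ltn_trans (\sum_(e <- E) M ^ k.-1)); last first.
  rewrite big_const_seq count_predT iter_addn_0 mulnC.
  case: k kn => [//|k] _ /=; rewrite expnS ltn_pmul2r ?expn_gt0//.
rewrite big_mkcond /= !big_seq; apply: leq_sum => e eE; case: eqP => // ek.
rewrite /w leq_pexp2l//; have /and3P[_ + _] := edgeE eE; rewrite ek.
by case: k {ek kn}.
Qed.

(** The edge (0, k) supplies what the vertex k lacks, for 1 <= k <= n, and (0, n+1) gets an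
    arbitrary positive value. Division by the total leaving 0 then makes it a unit flow. *)
Let fl (e : edge) : nat :=
  if e.1 == 0%N then
    if (e.2 <= n)%N then (\sum_(e' <- E | e'.1 == e.2) w e' - \sum_(e' <- E | e'.2 == e.2) w e')%N
    else 1%N
  else w e.

Lemma fl_gt0 e : e \in star r E -> (0 < fl e)%N.
Proof.
rewrite /fl mem_cat => /orP[/mapP[i]|/edgeE/and3P[e1 _ _]].
  rewrite mem_iota => ir -> /=; case: (leqP i n) => // i_n.
  by rewrite subn_gt0 inflow_lt_outflow//; lia.
by rewrite gtn_eqF// expn_gt0.
Qed.

Lemma big_star (P : pred edge) (F : edge -> R) :
  \sum_(e <- star r E | P e) F e =
  \sum_(i <- iota 1 r | P (0%N, i)) F (0%N, i) + \sum_(e <- E | P e) F e.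
Proof. by rewrite big_cat big_map. Qed.

Lemma flE (P : pred edge) :
  \sum_(e <- E | P e) (fl e)%:R = (\sum_(e <- E | P e) w e)%N%:R :> R.
Proof.
rewrite natr_sum big_seq_cond [RHS]big_seq_cond; apply: eq_bigr => e /andP[eE _].
by rewrite /fl; have /and3P[e1 _ _] := edgeE eE; rewrite gtn_eqF.
Qed.

Lemma forward_star : forward (star r E).
Proof.
apply/allP => e; rewrite mem_cat => /orP[/mapP[i]|/edgeE/and3P[]//].
by rewrite mem_iota => /andP[i1 _] ->.
Qed.

Lemma head_star e : e \in star r E -> (e.2 <= n.+1)%N.
Proof.
rewrite mem_cat => /orP[/mapP[i]|/edgeE/and3P[]//].
rewrite mem_iota add1n ltnS => /andP[_ ir] -> /=; apply: leq_trans ir _.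
by case/andP: nr.
Qed.

Lemma outdeg_star k : outdeg (star r E) k = ((k == 0)%N * r + outdeg E k)%N.
Proof.
rewrite /outdeg count_cat count_map; congr (_ + _)%N.
case: eqP => [->|k0]; first by rewrite mul1n (eq_count (a2 := predT))// count_predT size_iota.
by rewrite (eq_count (a2 := pred0)) ?count_pred0// => i; apply/negbTE; rewrite /= eq_sym; apply/eqP.
Qed.

Lemma outdeg_star_gt0 k : (k <= n)%N -> (0 < outdeg (star r E) k)%N.
Proof.
case: k => [|k] kn; rewrite outdeg_star ?mul1n ?mul0n; first by lia.
by rewrite add0n -has_count; apply: outE.
Qed.

Lemma sum_iota_eq (F : nat -> R) k : (1 <= k <= r)%N -> \sum_(i <- iota 1 r | i == k) F i = F k.
Proof.
move=> kr; rewrite (big_rem k) ?mem_iota//= eqxx big1_seq ?addr0// => i /andP[/eqP ->].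
by rewrite mem_rem_uniq ?iota_uniq// inE eqxx.
Qed.

Lemma positive_flow : exists f0 : 'rV[R]_(size (star r E)),
  flow_polytope R (star r E) (srcsink n) f0 /\ forall e, 0 < f0 ord0 e.
Proof.
pose S : R := \sum_(e <- star r E | e.1 == 0%N) (fl e)%:R.
have S0 : 0 < S.
  have e1 : (0%N, 1%N) \in star r E.
    by rewrite mem_cat map_f// mem_iota; lia.
  rewrite /S (big_rem _ e1) //= ltr_wpDr ?ltr0n ?fl_gt0//.
  by rewrite sumr_ge0.
exists (\row_i ((fl (ethe i))%:R / S)).
have pos i : 0 < (fl (ethe (E := star r E) i))%:R / S.
  by rewrite divr_gt0// ltr0n fl_gt0// mem_nth.
split; last by move=> e; rewrite mxE.
split=> [e|k]; first by rewrite mxE ltW.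
have nfE k' : netflow (star r E) (fun e => (\row_i ((fl (ethe i))%:R / S)) ord0 e) k' =
    (\sum_(e <- star r E | e.1 == k') (fl e)%:R - \sum_(e <- star r E | e.2 == k') (fl e)%:R) / S.
  rewrite -netflow_edges !netflowE mulr_suml; apply: eq_bigr => e _.
  by rewrite mxE mulrAC.
move: k; apply: (netflow_extend forward_star head_star).
- move=> k kn; rewrite nfE; case: k kn => [|k] kn.
    rewrite /srcsink /= -/S [X in _ - X]big1_seq ?subr0 ?mulfV ?gt_eqF//.
    by move=> e /andP[/eqP e2 /(allP forward_star)]; rewrite /= e2.
  rewrite /srcsink /= eqSS (ltn_eqF kn) !big_star !flE big1 ?add0r//.
  rewrite (sum_iota_eq (fun i => (fl (0%N, i))%:R)); last by lia.
  rewrite /fl /= kn natrB; last by rewrite ltnW// inflow_lt_outflow.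
  by rewrite opprD opprB [X in _ + (X + _)]addrC !addrA; ring.
- rewrite big_ord_recl big1 => [|i _]; first by rewrite /srcsink /= eqxx addr0.
  by rewrite /srcsink /= eqSS ltn_eqF.
- by move=> k nk; rewrite /srcsink !gtn_eqF// (leq_ltn_trans _ nk).
Qed.

End PositiveFlow.

(** * Noncrossing trees and staircases *)

Section Staircases.
Variables (P q : nat).
Hypothesis q0 : (0 < q)%N.
Implicit Type T : {set 'I_P.+1 * 'I_q}.

Definition chain T := forall x y, x \in T -> y \in T -> (x.1 < y.1)%N -> (x.2 <= y.2)%N.

Lemma rank_subproof (x : 'I_P.+1 * 'I_q) : (x.1 + x.2 < P + q)%N.
Proof. by rewrite -addnS leq_add// -ltnS. Qed.

Definition rank x := Ordinal (rank_subproof x).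

Lemma rank_inj T : chain T -> {in T &, injective rank}.
Proof.
move=> cT [x1 x2] [y1 y2] xT yT /(congr1 val) /= xy.
have /= lt1 := cT _ _ xT yT; have /= lt2 := cT _ _ yT xT.
have [xy1|xy1|xy1] := ltngtP x1 y1.
- by have := lt1 xy1; lia.
- by have := lt2 xy1; lia.
by congr (_, _); apply: val_inj => //=; lia.
Qed.

Lemma card_chain T : chain T -> (#|T| <= P + q)%N.
Proof.
move=> cT; rewrite -(card_in_imset (rank_inj cT)).
by rewrite (leq_trans (max_card _))// card_ord.
Qed.

Lemma card_ord_lt m s : (s <= m)%N -> #|[set i : 'I_m | (i < s)%N]%SET| = s.
Proof.
move=> sm; rewrite cardsE -sum1_card (eq_bigl (fun i : 'I_m => (i < s)%N)) //.
by rewrite -(big_ord_widen _ (fun=> 1%N) sm) sum_nat_const card_ord muln1.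
Qed.

(** A chain of maximal size P + q meets each of the P + q antidiagonals exactly once, so [rank]
    enumerates it. *)
Lemma card_rank_lt T s : chain T -> #|T| = (P + q)%N -> (s <= P + q)%N ->
  #|[set x in T | (rank x < s)%N]%SET| = s.
Proof.
move=> cT Tcard sPq.
have imT : rank @: T = [set: 'I_(P + q)]%SET.
  by apply/eqP; rewrite eqEcard finset.subsetT cardsT card_ord (card_in_imset (rank_inj cT))
    Tcard /=.
rewrite -[RHS](card_ord_lt sPq) -(card_in_imset (f := rank)); last first.
  by move=> x y; rewrite !inE => /andP[xT _] /andP[yT _]; apply: (rank_inj cT).
apply: eq_card => i; rewrite inE; apply/imsetP/idP.
  by case=> x; rewrite inE => /andP[_ xs] ->.
move=> lti; have : i \in rank @: T by rewrite imT inE.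
by case/imsetP => x xT ix; exists x => //; rewrite inE xT -ix.
Qed.

Definition ldeg T (p : 'I_P.+1) := #|[set x : 'I_q | (p, x) \in T]%SET|.

Lemma card_rows T (Q : pred nat) :
  #|[set x in T | Q x.1]%SET| = (\sum_(p < P.+1 | Q p) ldeg T p)%N.
Proof.
rewrite -sum1_card; under [RHS]eq_bigr do rewrite /ldeg -sum1_card.
rewrite pair_big_dep /=; apply: eq_bigl => -[x1 x2] /=.
by rewrite !inE andbC.
Qed.

Definition psum (y : 'I_P -> nat) (p : nat) := (\sum_(i < P | (i < p)%N) y i)%N.

Lemma psumS y (i : 'I_P) : psum y i.+1 = (psum y i + y i)%N.
Proof.
rewrite /psum (bigD1 i)//= addnC; congr (_ + _)%N; apply: eq_bigl => j.
by rewrite ltnS -(inj_eq val_inj) ltn_neqAle andbC.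
Qed.

Lemma psum0 y : psum y 0 = 0%N.
Proof. by rewrite /psum big_pred0. Qed.

Lemma psumT y : psum y P = (\sum_(i < P) y i)%N.
Proof. by apply: eq_bigl => i; rewrite ltn_ord. Qed.

Lemma psum_le y p p' : (p <= p')%N -> (psum y p <= psum y p')%N.
Proof.
move=> pp'; rewrite /psum big_mkcond [leqRHS]big_mkcond; apply: leq_sum => i _ /=.
by case: (ltnP i p) => // ip; rewrite (leq_trans ip pp').
Qed.

(** Row p fills the columns from [psum y p] to [psum y p.+1]. Neighbouring rows share a column,
    which gives connectedness; the last row runs to the end. *)
Definition stair (y : 'I_P -> nat) : {set 'I_P.+1 * 'I_q} :=
  [set pq : 'I_P.+1 * 'I_q | (psum y pq.1 <= pq.2)%N && ((pq.1 < P)%N ==> (pq.2 <= psum y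
    pq.1.+1)%N)]%SET.

Lemma stair_chain y : chain (stair y).
Proof.
move=> u v; rewrite !inE => /andP[_ /implyP u2] /andP[v1 _] uv.
have uP : (u.1 < P)%N by apply: leq_trans uv _; rewrite -ltnS.
by rewrite (leq_trans (u2 uP))// (leq_trans _ v1)// psum_le.
Qed.

Lemma card_ord_interval a b : (b < q)%N -> #|[set x : 'I_q | (a <= x <= b)%N]%SET| = (b.+1 - a)%N.
Proof.
move=> bq; have [ab|ba] := leqP a b.+1; last first.
  by rewrite (eqP (ltnW ba)); apply/eqP; rewrite cards_eq0; apply/eqP/setP => x; rewrite !inE; lia.
have E : [set x : 'I_q | (x < b.+1)%N]%SET =
    ([set x : 'I_q | (a <= x <= b)%N] :|: [set x : 'I_q | (x < a)%N])%SET.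
  by apply/setP => x; rewrite !inE; lia.
have := card_ord_lt bq; rewrite {}E cardsU card_ord_lt ?(leq_trans ab bq)//.
rewrite (_ : _ :&: _ = finset.set0)%SET ?cards0 ?subn0; first by lia.
by apply/setP => x; rewrite !inE; lia.
Qed.

Lemma ldeg_stair y (i : 'I_P) : (\sum_(i < P) y i < q)%N ->
  ldeg (stair y) (widen_ord (leqnSn P) i) = (y i).+1.
Proof.
rewrite -psumT => yq.
rewrite /ldeg (_ : finset _ = [set x : 'I_q | (psum y i <= x <= psum y i.+1)%N]%SET); last first.
  by apply/setP => x; rewrite !inE /= ltn_ord.
rewrite card_ord_interval ?psumS; first by lia.
by rewrite -psumS (leq_ltn_trans _ yq)// psum_le.
Qed.

Lemma ldeg_stair_max y : (\sum_(i < P) y i < q)%N -> ldeg (stair y) ord_max = (q - \sum_(i < P) y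
  i)%N.
Proof.
rewrite -psumT => yq.
rewrite /ldeg (_ : finset _ = [set x : 'I_q | (psum y P <= x <= q.-1)%N]%SET); last first.
  by apply/setP => x; rewrite !inE /= ltnn /= andbT; have := ltn_ord x; lia.
by rewrite card_ord_interval prednK.
Qed.

Lemma card_stair y : (\sum_(i < P) y i < q)%N -> #|stair y| = (P + q)%N.
Proof.
move=> yq; transitivity #|[set x in stair y | xpredT (val x.1)]%SET|.
  by apply: eq_card => x; rewrite !inE andbT.
rewrite (card_rows _ xpredT) big_ord_recr /= ldeg_stair_max//.
under eq_bigr do rewrite ldeg_stair//.
rewrite (eq_bigr (fun i : 'I_P => y i + 1)%N) => [|i _]; last by rewrite addn1.
rewrite big_split /= sum_nat_const card_ord muln1 [(_ + P)%N]addnC -addnA subnKC//.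
exact: ltnW.
Qed.

Lemma bip_adj_sym T : connect_sym (bip_adj T).
Proof. by apply: sym_connect_sym => -[x|x] [z|z]. Qed.

Lemma nc_stair y : (\sum_(i < P) y i < q)%N -> nc_tree (stair y).
Proof.
move=> yq; apply/and3P; split.
- by rewrite card_stair// addSn.
- suff H v : connect (bip_adj (stair y)) (inl ord0) v.
    by apply/forallP => u; apply/forallP => v; apply: connect_trans (H v); rewrite bip_adj_sym.
  have row m (mP : (m < P.+1)%N) : connect (bip_adj (stair y)) (inl ord0) (inl (Ordinal mP)).
    elim: m mP => [|m IH] mP; first by rewrite (_ : Ordinal mP = ord0)//; apply: val_inj.
    apply: connect_trans (IH (ltnW mP)) _.
    have xq : (psum y m.+1 < q)%N by rewrite (leq_ltn_trans _ yq)// -psumT psum_le.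
    apply: (@connect_trans _ _ (inr (Ordinal xq))); apply: connect1 => /=.
      by rewrite inE /= psum_le //= leqnn implybT.
    rewrite inE /= leqnn /=; apply/implyP => mP'; exact: psum_le.
  case: v => [[m mP]|x]; first exact: row.
  (* Column x is met by the last row that starts at or before x. *)
  have ex0 : exists m, (m <= P)%N && (psum y m <= x)%N by exists 0%N; rewrite psum0.
  have bd m : (m <= P)%N && (psum y m <= x)%N -> (m <= P)%N by case/andP.
  case: (ex_maxnP ex0 bd) => m /andP[mP mx] mmax.
  apply: connect_trans (row m mP) _; apply: connect1 => /=.
  rewrite inE /= mx /=; apply/implyP => mP'; rewrite leqNgt; apply/negP => ltx.
  by have := mmax m.+1; rewrite mP' (ltnW ltx) => /(_ isT); rewrite ltnn.
- do 4!(apply/forallP => ?); apply/implyP => /andP[H1 H2].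
  apply/negP => /andP[lt1]; rewrite ltnNge => /negP; apply.
  exact: (stair_chain H1 H2 lt1).
Qed.

Lemma nc_tree_chain T : nc_tree T -> chain T.
Proof.
case/and3P => _ _ /forallP nc [x1 x2] [y1 y2] xT yT /= lt1; rewrite leqNgt; apply/negP => lt2.
have /forallP/(_ x2)/forallP/(_ y1)/forallP/(_ y2) := nc x1.
by rewrite xT yT /= lt1 lt2.
Qed.

Lemma nc_tree_ldeg_gt0 T p : nc_tree T -> (0 < ldeg T p)%N.
Proof.
case/and3P => _ /forallP/(_ (inl p))/forallP/(_ (inr (Ordinal q0)))/connectP[] [|[x|x] s] //=.
by move=> /andP[pT _] _ _; apply/card_gt0P; exists x; rewrite inE.
Qed.

(** Rows are counted against antidiagonals: the rows before p hold [psum y p + p] elements of T, all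
    of smaller rank than (p, x), and exactly p + x elements have smaller rank; so [psum y p <= x].
    The upper bound is dual, and equality holds since no chain exceeds P + q elements. *)
Lemma nc_tree_stair T (y : 'I_P -> nat) : nc_tree T ->
  (forall i, ldeg T (widen_ord (leqnSn P) i) = (y i).+1) ->
  (\sum_(i < P) y i < q)%N /\ stair y = T.
Proof.
move=> ncT yE; have cT := nc_tree_chain ncT.
have cardT : #|T| = (P + q)%N by case/and3P: ncT => /eqP -> _ _; rewrite addSn.
have cum p : (p <= P)%N -> #|[set x in T | (x.1 < p)%N]%SET| = (psum y p + p)%N.
  move=> pP; rewrite (card_rows T (fun m => m < p)%N) big_mkcond big_ord_recr /= ltnNge pP addn0.
  rewrite -big_mkcond /=; under eq_bigr do rewrite yE -addn1.
  rewrite big_split /=; congr (_ + _)%N.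
  by rewrite -(big_ord_widen _ (fun=> 1%N) pP) sum_nat_const card_ord muln1.
have sub : T \subset stair y.
  apply/fintype.subsetP => -[p x] pxT; rewrite inE /=.
  have pP : (p <= P)%N by rewrite -ltnS.
  have rk := rank_subproof (p, x).
  apply/andP; split.
    rewrite -(leq_add2r p) -cum// addnC -(card_rank_lt cT cardT (ltnW rk)).
    apply/subset_leq_card/fintype.subsetP => -[z1 z2]; rewrite !inE /= => /andP[zT zp];
      rewrite zT /=.
    by have /= := cT _ _ zT pxT zp; lia.
  apply/implyP => ltp; rewrite -(leq_add2r p.+1) -cum// addnC addSn -(card_rank_lt cT cardT rk).
  apply/subset_leq_card/fintype.subsetP => -[z1 z2]; rewrite !inE /= => /andP[zT zp];
    rewrite zT /= ltnS leqNgt.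
  by apply/negP => pz; have /= := cT _ _ pxT zT pz; lia.
split.
  have /card_gt0P[x] := nc_tree_ldeg_gt0 ord_max ncT.
  rewrite inE => /(fintype.subsetP sub); rewrite inE /= psumT => /andP[yx _].
  exact: leq_ltn_trans yx _.
by apply/esym/eqP; rewrite eqEcard sub cardT card_chain//; exact: stair_chain.
Qed.

(** The last row, that of v_i, is left out, its degree being determined by the others. The bound [B]
    gives all trees one index type; [inord] is faithful when q <= B + 1. *)
Definition ydeg B T : {ffun 'I_P -> 'I_B.+1} :=
  [ffun i => inord (ldeg T (widen_ord (leqnSn P) i)).-1].

Lemma ydegE B T i : (q <= B.+1)%N -> nc_tree T -> ldeg T (widen_ord (leqnSn P) i) = (ydeg B T i).+1.
Proof.
move=> qB ncT; have := nc_tree_ldeg_gt0 (widen_ord (leqnSn P) i) ncT.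
have := max_card [set x : 'I_q | (widen_ord (leqnSn P) i, x) \in T]%SET.
rewrite -/(ldeg T _) card_ord ffunE => le gt; rewrite inordK ?prednK//.
by rewrite (leq_trans le).
Qed.

Lemma nc_tree_sum B (F : {ffun 'I_P -> 'I_B.+1} -> nat) : (q <= B.+1)%N ->
  (\sum_(T | nc_tree T) F (ydeg B T) =
   \sum_(y : {ffun 'I_P -> 'I_B.+1} | (\sum_(i < P) y i < q)%N) F y)%N.
Proof.
move=> qB.
have stairK T : nc_tree T -> stair (fun i => ydeg B T i) = T.
  by move=> ncT; have [] := nc_tree_stair ncT (fun i => ydegE i qB ncT).
rewrite (reindex_onto (fun y : {ffun 'I_P -> 'I_B.+1} => stair (fun i => y i)) (@ydeg B))//=.
have ydegK (y : {ffun 'I_P -> 'I_B.+1}) : (\sum_(i < P) y i < q)%N -> ydeg B (stair (fun i => y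
  i)) = y.
  by move=> yq; apply/ffunP => i; rewrite ffunE ldeg_stair//= inord_val.
rewrite (eq_bigl (fun y : {ffun 'I_P -> 'I_B.+1} => (\sum_(i < P) y i < q)%N)) => [|y].
  by apply: eq_bigr => y yq; rewrite ydegK.
apply/andP/idP => [[ncy /eqP yE]|yq]; last by rewrite nc_stair// ydegK.
by have [+ _] := nc_tree_stair ncy (fun i => ydegE i qB ncy); rewrite yE.
Qed.

End Staircases.

(** * One step of the reduction, on the side of flows *)

Lemma iota1_rcons m : iota 1 m.+1 = iota 1 m ++ [:: m.+1].
Proof. by rewrite -{1}(addn1 m) iotaD add1n. Qed.

Lemma Kcount_nil (v : nat -> int) : (forall k, v k = 0) -> Kcount [::] v = 1%N.
Proof.
move=> v0; rewrite (KcountE (B := 1)) => [||[]//]; last by [].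
have h0 : {ffun 'I_(size ([::] : seq edge)) -> 'I_1} by apply: finfun => -[].
rewrite (big_pred1 h0) => [|h]; last by apply/esym/eqP/ffunP => -[].
case: asboolP => // -[]; split=> [[]//|k].
by rewrite netflowE big_ord0 v0.
Qed.

(** The netflow once the vertices above i are processed: [o k] is the current demand at k, and 0
    supplies the total. *)
Definition svec (i : nat) (o : nat -> nat) (k : nat) : int :=
  if k == 0%N then (\sum_(j < i) o j.+1)%N%:Z else if (k <= i)%N then - (o k)%:Z else 0.

Lemma eq_svec i o o' : (forall k, (1 <= k <= i)%N -> o k = o' k) -> svec i o = svec i o'.
Proof.
move=> oo'; apply/funext => k; rewrite /svec; case: eqP => k0.
  by congr Posz; apply: eq_bigr => j _; rewrite oo' ?ltn_ord.
by case: ifP => // ki; rewrite oo'// ki lt0n; move/eqP: k0 => ->.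
Qed.

Lemma svec_prefix i o N : \sum_(k < N) svec i o k <= (\sum_(j < i) o j.+1)%N%:Z.
Proof.
case: N => [|N]; first by rewrite big_ord0.
rewrite big_ord_recl /svec /= gerDl; apply: sumr_le0 => k _.
by case: ifP => // _; rewrite oppr_le0.
Qed.

Section Stage.
Variables (i : nat) (H Ins : seq edge) (o : nat -> nat) (B : nat).
Hypothesis fH : forward H.
Hypothesis tailH : forall e, e \in H -> (0 < e.1)%N.
Hypothesis pIns : perm_eq Ins [seq e <- H | e.2 == i.+1].
Hypothesis oB : (\sum_(j < i.+1) o j.+1 <= B)%N.

Let Hi := [seq e <- H | (e.2 <= i)%N].
Let g j := nth (0%N, 0%N) Ins j.

Let mem_Ins e : e \in Ins -> [/\ e \in H, (0 < e.1)%N, (e.1 < i.+1)%N & e.2 = i.+1].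
Proof.
rewrite (perm_mem pIns) mem_filter => /andP[/eqP e2 eH]; split=> //; first exact: tailH.
by rewrite -e2; apply: (allP fH).
Qed.

Lemma perm_stage :
  perm_eq (star i.+1 [seq e <- H | (e.2 <= i.+1)%N]) ((0%N, i.+1) :: Ins ++ star i Hi).
Proof.
apply/permP => p; rewrite /star.
rewrite iota1_rcons map_cat.
rewrite !(count_cat, permP pIns) /= !count_cat !count_filter (permP pIns) count_filter addn0.
have -> : (count (predI p (fun e => e.2 <= i.+1)) H =
    count (predI p (fun e => e.2 == i.+1)) H + count (predI p (fun e => e.2 <= i)) H)%N.
  elim: H => //= e s ->; rewrite (leq_eqVlt e.2) ltnS.
  by case: (p e) => /=; case: (ltngtP e.2 i.+1); lia.
by rewrite [(count p _ + _)%N]addnC -addnA; congr (_ + _)%N; rewrite addnCA.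
Qed.

Lemma forward_stage : forward ((0%N, i.+1) :: Ins ++ star i Hi).
Proof.
apply/allP => e; rewrite inE mem_cat => /predU1P[-> //|/orP[/mem_Ins[_ _ + ->]//|]].
rewrite mem_cat => /orP[/mapP[j]|]; first by rewrite mem_iota => /andP[j1 _] ->.
by rewrite mem_filter => /andP[_ /(allP fH)].
Qed.

(** No remaining edge leaves i+1, so its inflow must be [o i.+1], and the flow on (0, i+1) is forced
    by the values y on [Ins]. Deleting these edges adds each y to the demand at the tail of its
    edge. *)
Lemma stage_step :
  Kcount (star i.+1 [seq e <- H | (e.2 <= i.+1)%N]) (svec i.+1 o) =
  (\sum_(y : {ffun 'I_(size Ins) -> 'I_B.+1} | (\sum_(j < size Ins) y j <= o i.+1)%N)
     Kcount (star i Hi) (svec i (fun r => o r + \sum_(j < size Ins | (g j).1 == r) y j)%N))%N.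
Proof.
have fS := forward_stage; have fE : forward (star i Hi) by apply/allP => e eE; apply: (allP fS);
  rewrite inE mem_cat eE !orbT.
have pS := perm_stage.
have fst : forward (star i.+1 [seq e <- H | (e.2 <= i.+1)%N]) by rewrite /forward (perm_all _ pS).
have vB N : \sum_(k < N) svec i.+1 o k < B.+1%:Z.
  by apply: le_lt_trans (svec_prefix _ _ _) _; rewrite ltz_nat ltnS.
rewrite (Kcount_perm _ fst pS) (Kcount_cons fS (vB _)).
have insE : Ins = mkseq g (size Ins) by rewrite mkseq_nth.
have vBr x N : \sum_(k < N) residual (svec i.+1 o) (0%N, i.+1) x k < B.+1%:Z.
  by rewrite prefix_residual//; apply: le_lt_trans (vB N); rewrite gerBl.
have step x : Kcount (Ins ++ star i Hi) (residual (svec i.+1 o) (0%N, i.+1) x) =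
    (\sum_(y : {ffun 'I_(size Ins) -> 'I_B.+1}) Kcount (star i Hi) (fun k =>
      (residual (svec i.+1 o) (0%N, i.+1) x k - \sum_(j < size Ins) (y j : nat)%:Z * dv (g j)
        k)%R))%N.
  rewrite {1}insE; apply: Kcount_mkseq_cat => [|j _]; last exact: vBr.
  by rewrite -insE; case/andP: fS.
under eq_bigr do rewrite step.
rewrite exchange_big [RHS]big_mkcond /=; apply: eq_bigr => y _.
have gP j : (j < size Ins)%N -> [/\ (0 < (g j).1)%N, ((g j).1 <= i)%N & (g j).2 = i.+1].
  by move=> js; have [] := mem_Ins (mem_nth (0%N, 0%N) js).
pose v x (k : nat) : int := residual (svec i.+1 o) (0%N, i.+1) x k - \sum_(j < size Ins) (y j :
  nat)%:Z * dv (g j) k.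
have [Y YE] : exists Y, Y = (\sum_(j < size Ins) y j)%N by eexists.
have vi x : v x i.+1 = x%:Z + Y%:Z - (o i.+1)%:Z.
  rewrite /v /residual /svec /dv /= leqnn eqxx.
  rewrite (eq_bigr (fun j : 'I_(size Ins) => - (y j : nat)%:Z)) => [|j _].
    by rewrite sumrN sum_Posz -YE; lia.
  by have [_ gi ->] := gP j (ltn_ord j); rewrite eqxx ltn_eqF// sub0r mulrN1.
have v0 x : v x i.+1 != 0 -> Kcount (star i Hi) (v x) = 0%N.
  apply: Kcount_isolated => // e; rewrite mem_cat => /orP[/mapP[j]|].
    by rewrite mem_iota => ji -> /=; lia.
  rewrite mem_filter => /andP[ei /(allP fH) e12].
  by rewrite !ltn_eqF// ltnS// (leq_trans (ltnW e12)).
rewrite -(big_mkord xpredT (fun x => Kcount (star i Hi) (v x))).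
have oiB : (o i.+1 <= B)%N by apply: leq_trans oB; rewrite big_ord_recr leq_addl.
rewrite -YE; case: (leqP Y (o i.+1)) => Yo; last first.
  by rewrite big1// => x _; apply: v0; rewrite vi -PoszD subr_eq0 eqz_nat gtn_eqF// (leq_trans
    Yo)// leq_addl.
rewrite (bigD1_seq (o i.+1 - Y)%N) ?iota_uniq ?mem_index_iota//=;
  last by rewrite ltnS (leq_trans (leq_subr _ _)).
rewrite big1 ?addn0 => [|x xo]; last first.
  by apply: v0; rewrite vi -PoszD subr_eq0 eqz_nat; apply: contra xo => /eqP <-; rewrite addnK.
apply: eq_Kcount => k.
have dvE : \sum_(j < size Ins) (y j : nat)%:Z * dv (g j) k =
    (\sum_(j < size Ins | (g j).1 == k) y j)%N%:Z - (k == i.+1)%:Z * Y%:Z.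
  rewrite YE -!sum_Posz mulr_sumr [in RHS]big_mkcond /= -sumrB; apply: eq_bigr => j _.
  have [_ _ g2] := gP j (ltn_ord j); rewrite /dv g2 [i.+1 == k]eq_sym.
  have boolE (a b : bool) (z : int) : z * (a%:Z - b%:Z) = (if a then z else 0) - b%:Z * z.
    by case: a; case: b => /=; ring.
  by rewrite boolE; case: ifP.
rewrite /v dvE /residual /dv /svec /=.
have [->|k0] := eqVneq k 0%N.
  rewrite [X in X%:Z - 0 * _]big1 => [|j /eqP g0]; last by have [] := gP j (ltn_ord j); rewrite g0.
  have -> : (\sum_(j < i) (o j.+1 + \sum_(j0 < size Ins | (g j0).1 == j.+1) y j0) =
      \sum_(j < i) o j.+1 + Y)%N.
    rewrite big_split /= YE; congr (_ + _)%N.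
    under eq_bigr do rewrite big_mkcond.
    rewrite exchange_big; apply: eq_bigr => j _ /=.
    have [g1 gi _] := gP j (ltn_ord j).
    have gi' : ((g j).1.-1 < i)%N by rewrite prednK.
    rewrite (bigD1 (Ordinal gi')) //= prednK// eqxx big1 ?addn0// => j' jj'.
    case: eqP => // gj; case/eqP: jj'; apply: val_inj => /=.
    by rewrite gj.
  by rewrite [in LHS]big_ord_recr /=; lia.
rewrite [i.+1 == k]eq_sym.
have [ki|ki|->] := ltngtP k i.+1.
- by rewrite -ltnS ki; lia.
- rewrite leqNgt (ltnW ki) /= big1 ?leqNgt ?ki //=; first by lia.
  by move=> j; have [_ gi _] := gP j (ltn_ord j); rewrite ltn_eqF// (leq_ltn_trans gi)// ltnW.
- rewrite ltnn big1; first by lia.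
  by move=> j; have [_ gi _] := gP j (ltn_ord j); rewrite ltn_eqF.
Qed.

End Stage.

(** * Leaves of the reduction tree *)

Lemma count_imset_rows P q (T : {set 'I_P.+1 * 'I_q}) (Q : pred nat) :
  count (fun pq : 'I_P.+1 * 'I_q => Q pq.1) (enum T) = (\sum_(p < P.+1 | Q p) ldeg T p)%N.
Proof.
rewrite -card_rows -sum1_card -sum1_count big_enum_cond /=.
by apply: eq_bigl => x; rewrite inE.
Qed.

Section ReduceChild.
Variables (i : nat) (H Ins Outs : seq edge) (B : nat).
Hypothesis fH : forward H.
Hypothesis tailH : forall e, e \in H -> (0 < e.1)%N.
Hypothesis pIns : perm_eq Ins [seq e <- H | e.2 == i.+1].
Hypothesis pOuts : perm_eq Outs [seq e <- H | e.1 == i.+1].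
Hypothesis OutsB : (size Outs <= B.+1)%N.
Hypothesis Outs0 : (0 < size Outs)%N.
Variable T : {set 'I_(size Ins).+1 * 'I_(size Outs)}.
Hypothesis ncT : nc_tree T.

Let mem_Outs j : (j < size Outs)%N -> (i.+1 < (nth (0%N, 0%N) Outs j).2)%N.
Proof.
move=> js; have := mem_nth (0%N, 0%N) js.
rewrite (perm_mem pOuts) mem_filter => /andP[/eqP <-]; exact: (allP fH).
Qed.

Let mem_Ins j : (j < size Ins)%N -> (0 < (nth (0%N, 0%N) Ins j).1 < i.+1)%N.
Proof.
move=> js; have := mem_nth (0%N, 0%N) js.
rewrite (perm_mem pIns) mem_filter => /andP[/eqP <-] eH.
by rewrite tailH//=; exact: (allP fH).
Qed.

Lemma reduce_child_mem e : e \in reduce_child i.+1 H Ins Outs T ->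
  (e \in H) || [&& (0 < e.1)%N, (e.1 <= i.+1)%N & (i.+1 < e.2)%N].
Proof.
rewrite mem_cat mem_filter => /orP[/andP[_ ->//]|/mapP[pq _ ->]] /=.
apply/orP; right; rewrite mem_Outs// andbT; case: (ltnP pq.1 (size Ins)) => pI //;
  last by rewrite leqnn.
by have /andP[-> /ltnW] := mem_Ins pI.
Qed.

Lemma reduce_child_forward : forward (reduce_child i.+1 H Ins Outs T).
Proof.
apply/allP => e /reduce_child_mem /orP[/(allP fH)//|/and3P[_ e1 e2]].
exact: leq_ltn_trans e1 e2.
Qed.

Lemma reduce_child_tail e : e \in reduce_child i.+1 H Ins Outs T -> (0 < e.1)%N.
Proof. by move=> /reduce_child_mem /orP[/tailH//|/and3P[]]. Qed.

(** New edges end beyond i+1 and deleted ones end at i+1 or beyond. The edges relevant to later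
    stages are thus those of [H]; only outdegrees change. *)
Lemma reduce_child_heads :
  [seq e <- reduce_child i.+1 H Ins Outs T | (e.2 <= i)%N] = [seq e <- H | (e.2 <= i)%N].
Proof.
rewrite filter_cat -filter_predI [X in _ ++ X](_ : _ = [::]) ?cats0.
  apply: eq_in_filter => e /(allP fH) /= e12; case: (leqP e.2 i) => //= e2i.
  by rewrite !ltn_eqF// (leq_trans e12)// leqW.
apply/eqP; rewrite -size_eq0 size_filter -leqn0 leqNgt -has_count; apply/negP => /hasP[e].
move=> /mapP[pq _ ->] /=.
by rewrite leqNgt (ltnW (mem_Outs (ltn_ord pq.2))).
Qed.

(** Each edge (r, i+1) is replaced by as many edges out of r as its left degree, a gain of its
    degree minus 1. This is the change of demand in [stage_step]. *)
Lemma outdeg_reduce_child r : (0 < r <= i)%N ->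
  outdeg (reduce_child i.+1 H Ins Outs T) r =
  (outdeg H r + \sum_(j < size Ins | (nth (0%N, 0%N) Ins j).1 == r) ydeg B T j)%N.
Proof.
move=> ri; rewrite /outdeg count_cat count_map /=.
pose Q m := (if (m < size Ins)%N then (nth (0%N, 0%N) Ins m).1 else i.+1) == r.
rewrite (eq_count (a2 := fun pq : 'I_(size Ins).+1 * 'I_(size Outs) => Q pq.1)) //.
rewrite count_imset_rows big_mkcond big_ord_recr /= /Q ltnn gtn_eqF; last by lia.
rewrite addn0 -big_mkcond /= count_filter.
rewrite (eq_bigl (fun j : 'I_(size Ins) => (nth (0%N, 0%N) Ins j).1 == r)); last first.
  by move=> j /=; rewrite ltn_ord.
under eq_bigr => j _ do rewrite (ydegE Outs0 _ OutsB ncT) -addn1.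
rewrite big_split /= addnA addnAC; congr (_ + _)%N.
have -> : (\sum_(j < size Ins | (nth (0%N, 0%N) Ins j).1 == r) 1)%N =
    count (fun e : edge => (e.1 == r) && (e.2 == i.+1)) H.
  rewrite -(big_mkord (fun j => (nth (0%N, 0%N) Ins j).1 == r) (fun=> 1%N)).
  rewrite -(big_nth (0%N, 0%N) (fun e : edge => e.1 == r) (fun=> 1%N)) sum1_count.
  by rewrite (permP pIns) count_filter.
elim: (H) => //= e s <-; case: (e.1 =P r) => [->|_] /=; last by [].
by rewrite ltn_eqF /=; [case: eqP; lia | lia].
Qed.

End ReduceChild.

(** The children of a node match the vectors y of [stage_step]. The resulting count does not mention
    the orderings chosen at the nodes, so every choice gives the same number of leaves. *)
Lemma canon_leaves_count i H c : forward H -> (forall e, e \in H -> (0 < e.1)%N) ->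
  (forall k, (1 <= k <= i)%N -> (0 < outdeg H k)%N) -> canon_leaves i H c ->
  c = Kcount (star i [seq e <- H | (e.2 <= i)%N]) (svec i (outm H)).
Proof.
elim: i H c => [|i IH] H c fH tH oH /=.
  move=> ->; rewrite (_ : [seq e <- H | _] = [::]).
    by rewrite Kcount_nil// => -[|k]; rewrite /svec //= big_ord0.
  apply/eqP; rewrite -size_eq0 size_filter -leqn0 leqNgt -has_count; apply/negP => /hasP[e].
  by move=> eH; have := allP fH _ eH; have := tH _ eH => /=; lia.
have stage Ins : perm_eq Ins [seq e <- H | e.2 == i.+1] ->
    Kcount (star i.+1 [seq e <- H | (e.2 <= i.+1)%N]) (svec i.+1 (outm H)) =
    (\sum_(y : {ffun 'I_(size Ins) -> 'I_(\sum_(j < i.+1) outm H j.+1).+1} |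
        (\sum_(j < size Ins) y j <= outm H i.+1)%N)
      Kcount (star i [seq e <- H | (e.2 <= i)%N])
        (svec i (fun r => outm H r + \sum_(j < size Ins | (nth (0%N, 0%N) Ins j).1 == r) y j)%N))%N.
  by move=> pI; apply: stage_step.
have noIns : ~~ has (fun e : edge => e.2 == i.+1) H ->
    Kcount (star i.+1 [seq e <- H | (e.2 <= i.+1)%N]) (svec i.+1 (outm H)) =
    Kcount (star i [seq e <- H | (e.2 <= i)%N]) (svec i (outm H)).
  rewrite has_filter negbK => /eqP I0; rewrite (stage [::]) ?I0//.
  have y0 : {ffun 'I_(size ([::] : seq edge)) -> 'I_(\sum_(j < i.+1) outm H j.+1).+1}.
    by apply: finfun => -[].
  rewrite (big_pred1 y0) => [|y]; last first.
    by rewrite /= big_ord0 leq0n; apply/esym/eqP/ffunP => -[].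
  by congr Kcount; apply: eq_svec => k _; rewrite big_ord0 addn0.
have oH' k : (1 <= k <= i)%N -> (0 < outdeg H k)%N.
  by move=> /andP[k1 ki]; apply: oH; rewrite k1 leqW.
(* The tree stops at vertex 2 while the flow count goes on to vertex 1; no edge of [H] enters that
   vertex, so its stage is trivial. *)
case: ifP => [|_].
  case: i IH stage noIns oH oH' => // IH _ noIns _ oH' _ ->.
  rewrite noIns; first by apply: (IH H) => //=.
  apply/hasP => -[e eH /eqP e2]; have := allP fH _ eH; have := tH _ eH.
  by rewrite /= e2; lia.
case: ifP => [nI|_]; first by rewrite noIns//; exact: IH.
case=> Ins [Outs [pI pO [cT [cTP ->]]]]; rewrite (stage Ins pI).
set B := (\sum_(j < i.+1) outm H j.+1)%N.
have sO : size Outs = outdeg H i.+1 by rewrite (perm_size pO) size_filter.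
have O0 : (0 < size Outs)%N by rewrite sO oH// leqnn.
have OB : (size Outs <= B.+1)%N.
  rewrite sO -(prednK (oH i.+1 _)) ?leqnn// ltnS /B big_ord_recr /=.
  exact: leq_addl.
pose F (y : {ffun 'I_(size Ins) -> 'I_B.+1}) := Kcount (star i [seq e <- H | (e.2 <= i)%N])
  (svec i (fun r => outm H r + \sum_(j < size Ins | (nth (0%N, 0%N) Ins j).1 == r) y j)%N).
rewrite (eq_bigr (fun T => F (ydeg B T))) => [|T ncT].
  rewrite (nc_tree_sum O0 F OB); apply: eq_bigl => y.
  by rewrite sO /outm -[RHS]ltnS prednK// oH// leqnn.
have oC k : (1 <= k <= i)%N -> outdeg (reduce_child i.+1 H Ins Outs T) k =
    (outdeg H k + \sum_(j < size Ins | (nth (0%N, 0%N) Ins j).1 == k) ydeg B T j)%N.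
  by move=> ki; apply: outdeg_reduce_child.
rewrite (IH _ _ _ _ _ (cTP T ncT)).
- rewrite (reduce_child_heads fH pO); congr Kcount; apply: eq_svec => k ki.
  by rewrite /outm oC// -!subn1 addnBAC// oH'.
- exact: reduce_child_forward.
- exact: reduce_child_tail.
- by move=> k ki; rewrite oC// addn_gt0 oH'.
Qed.

Lemma canon_leaves_exists i H : exists c, canon_leaves i H c.
Proof.
elim: i H => [|i IH] H /=; first by exists 1%N.
case: (i.+1 < 2)%N; first by exists 1%N.
case: (has _ H) => /=; last exact: IH.
set Ins := [seq e <- H | e.2 == i.+1]; set Outs := [seq e <- H | e.1 == i.+1].
have [cT cTP] := choice (fun T => IH (reduce_child i.+1 H Ins Outs T)).
exists (\sum_(T | nc_tree T) cT T)%N, Ins, Outs; split => //.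
by exists cT.
Qed.

(** * Conclusion *)

Section StandingGraph.
Variables (n : nat) (E : seq edge).
Hypothesis n0 : (0 < n)%N.
Hypothesis edgeE : forall e, e \in E -> [&& (1 <= e.1)%N, (e.1 < e.2)%N & (e.2 <= n.+1)%N].
Hypothesis outE : forall k, (1 <= k <= n)%N -> has (fun e : edge => e.1 == k) E.

Let fE : forward E.
Proof. by apply/allP => e /edgeE /and3P[]. Qed.

Let tailE e : e \in E -> (0 < e.1)%N.
Proof. by move=> /edgeE /and3P[]. Qed.

Let headE e : e \in E -> (e.2 <= n.+1)%N.
Proof. by move=> /edgeE /and3P[]. Qed.

Let outdegE k : (1 <= k <= n)%N -> (0 < outdeg E k)%N.
Proof. by move=> /outE; rewrite has_count. Qed.

Lemma outdeg_out k : (k == 0%N) || (n < k)%N -> outdeg E k = 0%N.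
Proof.
move=> k0n; apply/eqP; rewrite -leqn0 leqNgt -has_count; apply/negP => /hasP[e eE /eqP ek].
by have /and3P[] := edgeE eE; rewrite ek; move: k0n => /orP[/eqP ->//|]; lia.
Qed.

Lemma sum_outdeg : (\sum_(j < n) outdeg E j.+1 = size E)%N.
Proof.
under eq_bigr do rewrite /outdeg -sum1_count big_mkcond.
rewrite exchange_big /= -sum1_size big_seq [RHS]big_seq; apply: eq_bigr => e eE.
have /and3P[e1 e12 e2] := edgeE eE; have en : (e.1.-1 < n)%N by lia.
rewrite (bigD1 (Ordinal en)) //= prednK// eqxx big1 // => j jE.
case: eqP => // ej; case/eqP: jE; apply: val_inj => /=.
by rewrite ej.
Qed.

Lemma sum_outm : (\sum_(j < n) outm E j.+1 + n = size E)%N.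
Proof.
rewrite -sum_outdeg -[X in (_ + X)%N]card_ord -sum1_card -big_split /=.
by apply: eq_bigr => j _; rewrite addn1 /outm prednK// outdegE//= ltn_ord.
Qed.

Lemma cvecE : cvec n E = svec n (outm E).
Proof. by apply/funext => k; rewrite /cvec /svec -sum_outm addnK. Qed.

(** The vertex n+1 has netflow 0 and no outgoing edges, so edges into it carry nothing, including
    (0, n+1) when r = n+1. This makes the two volumes equal. *)
Lemma Kcount_star_drop r : (n <= r <= n.+1)%N ->
  Kcount (star r E) (cvec n E) = Kcount (star n [seq e <- E | (e.2 <= n)%N]) (svec n (outm E)).
Proof.
move=> nr; rewrite (@Kcount_drop_sink n.+1).
- rewrite cvecE filter_cat; congr Kcount; congr (_ ++ _); last first.
    by apply: eq_in_filter => e /headE h; rewrite neq_ltn [(n.+1 < _)%N]ltnNge h orbF ltnS.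
  rewrite filter_map; congr map; have [->|->] : r = n \/ r = n.+1 by lia.
    by apply/all_filterP/allP => i; rewrite mem_iota /=; lia.
  rewrite iota1_rcons filter_cat /= eqxx cats0.
  by apply/all_filterP/allP => i; rewrite mem_iota /=; lia.
- exact: (forward_star r edgeE).
- move=> e; rewrite mem_cat => /orP[/mapP[i _ ->]//|/edgeE/and3P[_ e12 e2]].
  by rewrite ltn_eqF// (leq_trans e12).
- by rewrite /cvec /= ltnn.
Qed.

(** Fixing the flows j_i on the edges (0, i) leaves the netflow j - out on [E]. A wrong total
    violates conservation at 0, and a failure of dominance makes a prefix sum negative, so the
    restriction in [sum_b] omits only zero terms. *)
Lemma sum_bE : sum_b n E = Kcount (star n E) (cvec n E).
Proof.
have starE : star n E = mkseq (fun i => (0%N, i.+1)) n ++ E.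
  by rewrite /star /mkseq -[1%N]addn0 iotaDl -map_comp.
rewrite starE (Kcount_mkseq_cat (B := (size E - n).+1)); first last.
- by move=> i _; rewrite big_ord1 /cvec /=; lia.
- by rewrite -starE; apply: (forward_star n edgeE).
rewrite /sum_b big_mkcond; apply: eq_bigr => y _.
pose v (k : nat) : int := cvec n E k - \sum_(i < n) (y i : nat)%:Z * dv (0%N, i.+1) k.
rewrite -/v; set S := (\sum_(i < n) (y i : nat))%N.
have dvE k : \sum_(i < n) (y i : nat)%:Z * dv (0%N, i.+1) k =
    (k == 0%N)%:Z * S%:Z - (\sum_(i < n | i.+1 == k) y i)%N%:Z.
  rewrite -!sum_Posz mulr_sumr [X in _ - X]big_mkcond -sumrB; apply: eq_bigr => i _.
  rewrite /dv /= [0%N == k]eq_sym; case: (k == 0%N); case: (i.+1 == k) => /=; ring.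
have v0 : v 0%N = (size E - n)%N%:Z - S%:Z.
  by rewrite /v dvE big_pred0// /cvec /=; ring.
have vS (k : 'I_n) : v k.+1 = (y k : nat)%:Z - (outm E k.+1)%:Z.
  rewrite /v dvE (big_pred1 k) => [|i]; last by rewrite /= eqSS.
  by rewrite /cvec /= ltn_ord; ring.
have vbig k : (n < k)%N -> v k = 0.
  move=> nk; rewrite /v dvE big_pred0 => [|i]; last by rewrite ltn_eqF// (leq_ltn_trans _ nk).
  by rewrite /cvec leqNgt nk gtn_eqF /=; [ring | lia].
have zero : Kcount E v != 0%N -> weak_comp_dom n E y.
  move=> Kv; apply/andP; split.
    apply: contraNT Kv => SE; apply/eqP; apply: (Kcount_prefix_neq0 (N := 1)) => //.
      by move=> e /tailE ->.
    by rewrite big_ord1 v0 subr_eq0 eqz_nat eq_sym.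
  apply/forallP => l; apply: contraNT Kv; rewrite -ltnNge => lt.
  have SE : S = (size E - n)%N \/ S <> (size E - n)%N by case: (S =P (size E - n)%N); [left|right].
  case: SE => SE; last first.
    apply/eqP; apply: (Kcount_prefix_neq0 (N := 1)) => //; first by move=> e /tailE ->.
    by rewrite big_ord1 v0 subr_eq0 eqz_nat eq_sym; apply/eqP.
  apply/eqP; apply: (Kcount_prefix_lt0 (N := l.+1)) => //.
  rewrite big_ord_recl v0 SE subrr add0r.
  have ln : (l <= n)%N by rewrite -ltnS.
  rewrite (big_ord_widen n (fun k => v k.+1) ln).
  by under eq_bigr do rewrite vS; rewrite sumrB !sum_Posz subr_lt0 ltz_nat.
have [wc|nwc] := boolP (weak_comp_dom n E y); last first.
  by apply/esym/eqP; apply: contraNT nwc.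
apply: eq_Kcount => k; rewrite /bvec.
case: k => [|k]; first by rewrite v0; case/andP: wc => /eqP; rewrite -/S => ->; rewrite subrr.
have [kn|kn] := ltnP k n; last by rewrite vbig.
rewrite (vS (Ordinal kn)) /= (nth_map (Ordinal kn)) ?size_enum_ord//.
by congr (_%:Z - _); congr (nat_of_ord (y _)); apply: val_inj; rewrite /= nth_enum_ord.
Qed.

Lemma canonical_cells_count c : canonical_cells n E c -> c = sum_b n E.
Proof.
move=> /(canon_leaves_count fE tailE outdegE) ->.
by rewrite sum_bE Kcount_star_drop ?leqnn ?leqnSn.
Qed.

Lemma volume_star (R : realType) r : (n <= r <= n.+1)%N ->
  has_normalized_volume (flow_polytope R (star r E) (srcsink n)) (sum_b n E)%:R.
Proof.
move=> nr; set H := star r E.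
have fH : forward H by apply: (forward_star r edgeE).
have hH e : e \in H -> (e.2 <= n.+1)%N by apply: (head_star nr edgeE).
have oH k : (k <= n)%N -> (0 < outdeg H k)%N by apply: outdeg_star_gt0 n0 nr outE k.
have oS k : outm H k.+1 = outm E k.+1 by rewrite /outm outdeg_star.
have o0 : outm H 0 = r.-1 by rewrite /outm outdeg_star mul1n outdeg_out// addn0.
have sH : size H = (r + size E)%N by rewrite size_cat size_map size_iota.
(* Each of the vertices 0, ..., n has outdegree one more than [outm], so the growth exponent is the
   number of edges minus n+1, the dimension. *)
have dE : (\sum_(i < n.+2) outm H i = size H - n.+1)%N.
  rewrite big_ord_recl big_ord_recr /= o0 oS /outm outdeg_out ?ltnSn ?orbT//= addn0.
  rewrite sH; under eq_bigr => i _ do rewrite -/(outm H _) oS.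
  by have := sum_outm; set S := (\sum_(i < n) _)%N; lia.
have [G [GE G0 Gd]] := Kcount_srcsink fH hH oH.
rewrite dE in G0 Gd.
exists (size H - n.+1)%N; split.
  have [f0 [f0P f0gt0]] := positive_flow R n0 nr edgeE outE.
  exact: (affine_dim_flow fH hH oH f0P f0gt0).
have -> : sum_b n E = G (size H - n.+1)%N.
  rewrite Gd sum_bE !Kcount_star_drop ?leqnn ?leqnSn// -(Kcount_star_drop nr).
  (* At vertex 0 the entry is d - out_0 = (m + r - n - 1) - (r - 1) = m - n, for both values of
     r. *)
  apply: eq_Kcount => -[|k]; rewrite /demand /cvec /upd /= ?o0 ?sH.
    by have := sum_outm; set S := (\sum_(i < n) _)%N; lia.
  rewrite oS; case: ltnP => kn; first by rewrite sub0r.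
  by rewrite /outm outdeg_out// ltnS kn.
apply: (@cvg_trans _ ((fun t : nat => (btr (t + outm H 0) G)%:R / t%:R ^+ (size H - n.+1) : R) @
  \oo)); last exact: cvg_btr.
apply: near_eq_cvg; near=> t.
by rewrite grid_count_flow ?GE//; near: t; exact: nbhs_infty_gt.
Unshelve. all: by end_near. Qed.

End StandingGraph.

Theorem theorem6p6 (R : realType) (n : nat) (E : seq (nat * nat)) (a : nat -> int) :
  (0 < n)%N -> standing_graph n E -> (forall i, (1 <= i <= n)%N -> 0 < a i) ->
  ((exists c, canonical_cells n E c) /\ (forall c, canonical_cells n E c -> c = sum_b n E)) /\
  lattice_points (flow_polytope R (Gstar n E) (cvec n E)) = sum_b n E /\
  has_normalized_volume (flow_polytope R (Gstar n E) (srcsink n)) (sum_b n E)%:R /\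
  has_normalized_volume (flow_polytope R (Gcirc n E) (srcsink n)) (sum_b n E)%:R.
Proof.
move=> n0 [edgeE outE _] _; split; [split|split; [|split]].
- exact: canon_leaves_exists.
- by move=> c; apply: canonical_cells_count.
- by rewrite lattice_points_flow sum_bE.
- by apply: (volume_star n0 edgeE outE R (r := n)); rewrite leqnn leqnSn.
- by apply: (volume_star n0 edgeE outE R (r := n.+1)); rewrite leqnn leqnSn.
Qed.
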